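(* Let $G$ and $G'$ be simple digraphs with the same number of vertices, $n_G=n_{G'}$. Then the following are equivalent: (1) $\zeta_G^{\uparrow\downarrow}=\zeta_{G'}^{\uparrow\downarrow}$ (equality of reversing zeta functions); (2) $\eta_G=\eta_{G'}$ (equality of generalized characteristic polynomials); (3) $\eta_{S\succ G}=\eta_{S\succ G'}$ for every invader $S$; (4) $\chi_{S\succ G}=\chi_{S\succ G'}$ for every invader $S$; (5) $\chi_{S\succ G}=\chi_{S\succ G'}$ for every invader $S$ with two vertices whose adjacency matrix satisfies $A_S\in\mathbb{Z}_{>0}^{2\times 2}$.
   Context: Digraphs are finite. In general, an (unweighted) digraph may have loops and parallel edges. For a digraph $H$, $n_H$ is the number of vertices, $A_H\in\mathbb{Z}_{\ge 0}^{n_H\times n_H}$ is the adjacency matrix ($[A_H]_{ij}$ is the number of edges from vertex $i$ to vertex $j$), $D_H^{\mathrm{out}}$ is the diagonal matrix of row sums of $A_H$, and $D_H^{\mathrm{in}}$ is the diagonal matrix of row sums of $A_H^T$. A simple digraph has no loops and no parallel edges (both $(v,v')$ and $(v',v)$ may be edges). Characteristic polynomials: $\chi_H(x)=\det(xI_{n_H}-A_H)$, and the generalized characteristic polynomial is $$\eta_H(x,t_\uparrow,t_\downarrow,u_\uparrow,u_\downarrow)=\det\big(xI_{n_H}+t_\uparrow D_H^{\mathrm{out}}+t_\downarrow D_H^{\mathrm{in}}+u_\uparrow A_H+u_\downarrow A_H^T\big).$$ Reversing zeta function of a simple digraph $G$ (all edge weights equal to $1$): Let $G_{\updownarrow}$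 be the digraph obtained from $G$ by adding, for each edge $e=(v,v')$ of $G$, a new reverse edge $(v',v)$ (added as a new, parallel edge even if $G$ already contains $(v',v)$). Edges belonging to $G$ have direction $\uparrow$, added edges have direction $\downarrow$; write $\mathrm{dir}(e)$ for the direction. For edges $e,e'$ of $G_{\updownarrow}$ write $e\rightleftarrows e'$ if the tail of $e'$ is the head of $e$ and the head of $e'$ is the tail of $e$. A circuit is a sequence of edges $\gamma=(e_1,\dots,e_\ell)$, $\ell\ge 1$, such that the head of $e_i$ is the tail of $e_{i+1}$ for all $i$, with $e_{\ell+1}=e_1$. A cycle $[\gamma]$ is an equivalence class of circuits under cyclic permutation of edges; it is primitive if none of its representatives is a $k$-fold concatenation of a circuit with itself for some $k\ge 2$. For $d,d'\in\{\uparrow,\downarrow\}$ put $|\gamma|_d=|\{i: \mathrm{dir}(e_i)=d\}|$ and $b_{dd'}(\gamma)=|\{i\in\{1,\dots,\ell\}:\mathrm{dir}(e_i)=d,\ \mathrm{dir}(e_{i+1})=d',\ e_i\rightleftarrows e_{i+1}\}|$ (indices cyclic). With $\mathcal{P}_{G_\updownarrow}$ the set of primitive cycles of $G_{\updownarrow}$, $$\zeta_G^{\uparrow\downarrow}(t_\uparrow,t_\downarrow,u_\uparrow,u_\downarrow)=\prod_{[\gamma]\in\mathcal{P}_{G_\updownarrow}}\frac{1}{1-t_\uparrow^{\,b_{\uparrow\downarrow}(\gamma)}\,t_\downarrow^{\,b_{\downarrow\uparrow}(\gamma)}\,u_\uparrow^{|\gamma|_\uparrow}\,u_\downarrow^{|\gamma|_\downarrow}},$$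 for small arguments, or equivalently as a formal power series in $u_\uparrow,u_\downarrow$ with coefficients polynomial in $t_\uparrow,t_\downarrow$. Invasions: An invader is a digraph $S$ (loops and parallel edges allowed) with $n_S\ge 2$ vertices, listed in order; the first vertex $t$ and the last vertex $h$ are called native. For a digraph $G$, the invaded digraph $S\succ G$ is obtained by replacing each edge $(v,v')$ of $G$ with a copy of $S$, where $v$ and $v'$ are identified with the first and the last vertex of that copy, respectively (all other vertices of the copies are new and distinct). *)

(* Defs.v *)
From HB Require Import structures.
From mathcomp Require Export all_boot all_order all_algebra.
From mathcomp Require Export mpoly.

Set Implicit Arguments.
Unset Strict Implicit.
Unset Printing Implicit Defensive.

Import GRing.Theory.
Local Open Scope ring_scope.

Record digraph := Digraph {
  vert : finType;
  edge : finType;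
  etail : edge -> vert;
  ehead : edge -> vert
}.

Definition simple_digraph (H : digraph) : Prop :=
  (forall e : edge H, etail e != ehead e) /\
  (forall e e' : edge H, etail e = etail e' -> ehead e = ehead e' -> e = e').

(* Rows and columns follow the order of [enum (vert H)]. *)
Definition adj_mx (H : digraph) : 'M[int]_#|vert H| :=
  \matrix_(i, j)
    #|[set e : edge H | (etail e == enum_val i) && (ehead e == enum_val j)]|%:Z.

Definition rowsum_mx (R : comNzRingType) (n : nat) (A : 'M[R]_n) : 'M[R]_n :=
  diag_mx (\row_i \sum_j A i j).

Definition chi (H : digraph) : {poly int} := char_poly (adj_mx H).

(* The variables x, t_up, t_dn, u_up, u_dn are numbered 0, 1, 2, 3, 4; the
   degree matrices D^out and D^in are [rowsum_mx A] and [rowsum_mx A^T]. *)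
Definition eta (H : digraph) : {mpoly int[5]} :=
  let A := map_mx (@mpolyC 5 int) (adj_mx H) in
  let Z i : {mpoly int[5]} := 'X_i in
  \det ((Z (@Ordinal 5 0 isT))%:M
        + Z (@Ordinal 5 1 isT) *: rowsum_mx A
        + Z (@Ordinal 5 2 isT) *: rowsum_mx A^T
        + Z (@Ordinal 5 3 isT) *: A
        + Z (@Ordinal 5 4 isT) *: A^T).

Section Circuits.
Variable H : digraph.

(* Indices are cyclic: [ordS] is the successor modulo l on ['I_l]. *)
Definition circuit (l : nat) (g : l.-tuple (edge H)) : bool :=
  (0 < l)%N && [forall i, ehead (tnth g i) == etail (tnth g (ordS i))].

Definition rotation (l : nat) (g g' : l.-tuple (edge H)) : bool :=
  [exists r : 'I_l, tval g' == rot r g].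

Lemma rotation_equiv (l : nat) : (0 < l)%N -> equivalence_rel (@rotation l).
Proof.
move=> l0 x y z.
have rotE (g g' : l.-tuple (edge H)) r : tval g' = rot r g -> rotation g g'.
  move=> e; case: (ltnP r l) => hr.
    by apply/existsP; exists (Ordinal hr); rewrite e.
  by apply/existsP; exists (Ordinal l0); rewrite e /= rot0 rot_oversize ?size_tuple.
split; first by apply: (rotE _ _ 0%N); rewrite rot0.
case/existsP=> r /eqP yE.
apply/existsP/existsP => -[q /eqP zE]; apply/existsP.
  apply: (rotE _ _ (rot_add y (l - r) q)).
  rewrite zE -rot_rot_add; congr rot.
  by rewrite yE -[LHS](rotK r) /rotr size_rot size_tuple.
by apply: (rotE _ _ (rot_add x r q)); rewrite zE yE rot_rot_add.
Qed.

Let tnth_rot1 l (g g' : l.-tuple (edge H)) i :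
  tval g' = rot 1 g -> tnth g' i = tnth g (ordS i).
Proof.
move: (tnth g i) => x0 g'E; rewrite !(tnth_nth x0) g'E.
case: l g i {g' g'E} => [|l] g i; first by case: i.
case/tupleP: g => y t /=.
rewrite rot1_cons nth_rcons size_tuple.
have := ltn_ord i; rewrite ltnS leq_eqVlt.
case/orP=> [/eqP ->|it]; first by rewrite ltnn eqxx modnn.
by rewrite it modn_small ?ltnS.
Qed.

Lemma rotation_tnth (l : nat) (g g' : l.-tuple (edge H)) : rotation g g' ->
  exists f : 'I_l -> 'I_l, [/\ injective f, forall i, f (ordS i) = ordS (f i)
    & forall i, tnth g' i = tnth g (f i)].
Proof.
case/existsP=> -[r /= rl] /eqP g'E.
elim: r rl g' g'E => [|r IH] rl g' g'E.
  exists id; split=> // i; congr tnth.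
  by apply: val_inj; rewrite /= g'E rot0.
have [f [injf fS gE]] := IH (ltnW rl) [tuple of rot r g] erefl.
exists (f \o (@ordS l)); split=> [||i] /=.
- exact: inj_comp injf (@ordS_inj l).
- by move=> i /=; rewrite fS.
rewrite -gE; apply: tnth_rot1.
by rewrite g'E rotS ?size_tuple // ltnW.
Qed.

(* The number k of repetitions and the length m of the repeated circuit are
   at most l, so bounding them by l loses nothing. *)
Definition primitive_circuit (l : nat) (g : l.-tuple (edge H)) : bool :=
  circuit g &&
  [forall g' : l.-tuple (edge H), rotation g g' ==>
    ~~ [exists k : 'I_l.+1, exists m : 'I_l.+1, exists d : m.-tuple (edge H),
          [&& (1 < k)%N, circuit d & tval g' == flatten (nseq k (tval d))]]].

Definition primitive_circuits (l : nat) : {set l.-tuple (edge H)} :=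
  [set g | primitive_circuit g].

Definition primitive_cycles (l : nat) : {set {set l.-tuple (edge H)}} :=
  equivalence_partition (@rotation l) (primitive_circuits l).

(* One circuit out of each primitive cycle of length l. *)
Definition primitive_reps (l : nat) : {set l.-tuple (edge H)} :=
  transversal (primitive_cycles l) (primitive_circuits l).

Definition backtracks (e e' : edge H) : bool :=
  (etail e' == ehead e) && (ehead e' == etail e).

End Circuits.

(* The direction of an edge of the reversing double is its boolean component:
   true for the edges of G, false for the added reverse edges. *)
Definition reversing_double (G : digraph) : digraph :=
  @Digraph (vert G) (edge G * bool)%type
    (fun e => if e.2 then etail e.1 else ehead e.1)
    (fun e => if e.2 then ehead e.1 else etail e.1).

Section Zeta.
Variable G : digraph.
Local Notation E := (edge (reversing_double G)).

Definition dir (e : E) : bool := e.2.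

Definition ndir (d : bool) (l : nat) (g : l.-tuple E) : nat :=
  #|[set i : 'I_l | dir (tnth g i) == d]|.

Definition nback (d d' : bool) (l : nat) (g : l.-tuple E) : nat :=
  #|[set i : 'I_l | [&& dir (tnth g i) == d, dir (tnth g (ordS i)) == d'
                      & backtracks (tnth g i) (tnth g (ordS i))]]|.

Definition v_up : 'I_2 := @Ordinal 2 0 isT.
Definition v_dn : 'I_2 := @Ordinal 2 1 isT.

(* A polynomial in u_up, u_dn whose coefficients are polynomials in t_up, t_dn. *)
Definition weight (l : nat) (g : l.-tuple E) : {mpoly {mpoly int[2]}[2]} :=
  ('X_v_up ^+ nback true false g * 'X_v_dn ^+ nback false true g) *:
    ('X_v_up ^+ ndir true g * 'X_v_dn ^+ ndir false g).

(* The Euler product cut off at cycle length N, with each factor 1 / (1 - w)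
   expanded as the geometric series 1 + w + ... + w^N.  As [weight g] has degree
   l in u_up, u_dn, nothing is lost in degree at most N. *)
Definition zeta_part (N : nat) : {mpoly {mpoly int[2]}[2]} :=
  \prod_(1 <= l < N.+1) \prod_(g in primitive_reps (reversing_double G) l)
    \sum_(0 <= k < N.+1) weight g ^+ k.

(* The formal power series in u_up, u_dn: [zeta m] is the coefficient of the
   monomial u^m, a polynomial in t_up, t_dn.  It is the eventual value of the
   coefficients of the partial products, by [zeta_stable]. *)
Definition zeta (m : 'X_{1..2}) : {mpoly int[2]} := (zeta_part (mdeg m))@_m.

Let cong (d : nat) (p q : {mpoly {mpoly int[2]}[2]}) : Prop :=
  forall m, (mdeg m <= d)%N -> p@_m = q@_m.

Let congM d p p' q q' : cong d p p' -> cong d q q' -> cong d (p * q) (p' * q').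
Proof.
move=> hp hq m hm; rewrite !mcoeffM; apply: eq_bigr => -[k1 k2] _ /=.
have h (k : 'X_{1..2 < (mdeg m).+1}) : (mdeg k <= d)%N.
  by apply: leq_trans hm; rewrite -ltnS bmdeg.
by rewrite hp ?hq.
Qed.

Let ndirD l (g : l.-tuple E) : (ndir true g + ndir false g)%N = l.
Proof.
rewrite -[RHS]card_ord -(cardC [set i : 'I_l | dir (tnth g i) == true]).
congr (_ + _)%N; apply: eq_card => i; rewrite !inE.
by case: (dir _).
Qed.

Let weightE l (g : l.-tuple E) k : exists c : {mpoly int[2]}, exists2 u : 'X_{1..2},
  mdeg u = (l * k)%N & weight g ^+ k = c *: 'X_[u].
Proof.
exists (('X_v_up ^+ nback true false g * 'X_v_dn ^+ nback false true g) ^+ k).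
exists ((U_(v_up) *+ ndir true g + U_(v_dn) *+ ndir false g) *+ k)%MM.
  by rewrite mdegMn mdegD !mdegMn !mdeg1 !mul1n ndirD.
by rewrite /weight exprZn -mpolyXn mpolyXD -!mpolyXn.
Qed.

Lemma weight_low l (g : l.-tuple E) k m :
  mdeg m != (l * k)%N -> (weight g ^+ k)@_m = 0.
Proof.
have [c [u hu ->]] := weightE g k; rewrite mcoeffZ mcoeffX => hm.
by case: eqP => [e|_]; [rewrite -e hu eqxx in hm | rewrite mulr0].
Qed.

Lemma weight_rotation l (g g' : l.-tuple E) :
  rotation g g' -> weight g = weight g'.
Proof.
move=> /rotation_tnth[f [injf fS gE]].
have cardf (P : pred 'I_l) : #|[set i | P (f i)]| = #|[set i | P i]|.
  rewrite -[RHS](on_card_preimset (onW_bij _ (injF_bij injf))).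
  by apply: eq_card => i; rewrite !inE.
have ndirE d : ndir d g' = ndir d g.
  by rewrite /ndir -[RHS]cardf; apply: eq_card => i; rewrite !inE gE.
have nbackE d d' : nback d d' g' = nback d d' g.
  by rewrite /nback -[RHS]cardf; apply: eq_card => i; rewrite !inE !gE fS.
by rewrite /weight !ndirE !nbackE.
Qed.

Let zeta_partS N : cong N (zeta_part N.+1) (zeta_part N).
Proof.
have hw l (g : l.-tuple E) k : (N < l * k)%N -> cong N (weight g ^+ k) 0.
  move=> h m hm; rewrite weight_low ?mcoeff0 //.
  by rewrite neq_ltn (leq_ltn_trans hm h).
rewrite /zeta_part (big_nat_recr N.+1) //= -[X in cong N _ X]mulr1.
apply: congM.
  rewrite [X in cong _ X _]big_nat [X in cong _ _ X]big_nat.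
  elim/big_rec2: _ => // l p q /andP[l0 _] hpq; apply: congM => //.
  elim/big_rec2: _ => // g p' q' _ hpq'; apply: congM => //.
  move=> m hm; rewrite big_nat_recr //= mcoeffD (hw _ _ _ _ m hm) ?mcoeff0 ?addr0 //.
  by rewrite leq_pmull.
elim/big_ind: _ => //.
  by move=> p q hp hq; rewrite -[X in cong N _ X]mulr1; apply: congM.
move=> g _ m hm; rewrite big_nat_recl //= expr0 mcoeffD raddf_sum big1 ?addr0 //.
by move=> k _ /=; rewrite (hw _ _ _ _ m hm) ?mcoeff0 // leq_pmulr.
Qed.

Lemma zeta_stable N m : (mdeg m <= N)%N -> (zeta_part N)@_m = zeta m.
Proof.
rewrite /zeta => /subnK <-; elim: (N - _)%N => // d IH.
by rewrite addSn zeta_partS ?leq_addl.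
Qed.

End Zeta.

(* The vertices are listed as 0, ..., ninner + 1; vertex 0 and vertex ninner + 1
   are the native ones. *)
Record invader := Invader {
  ninner : nat;
  iedge : finType;
  itail : iedge -> 'I_ninner.+2;
  ihead : iedge -> 'I_ninner.+2
}.

Definition digraph_of_invader (S : invader) : digraph :=
  @Digraph 'I_(ninner S).+2 (iedge S) (@itail S) (@ihead S).

Coercion digraph_of_invader : invader >-> digraph.

Section Invasion.
Variables (S : invader) (G : digraph).

Definition inner_vert := {i : 'I_(ninner S).+2 | (i != ord0) && (i != ord_max)}.

(* The vertex of the invaded digraph at position i in the copy of S on e. *)
Definition place (e : edge G) (i : 'I_(ninner S).+2) :
    (vert G + edge G * inner_vert)%type :=
  if insub i is Some j then inr (e, j)
  else inl (if i == ord0 then etail e else ehead e).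

Definition invaded : digraph :=
  @Digraph (vert G + edge G * inner_vert)%type (edge G * iedge S)%type
    (fun f => place f.1 (itail f.2)) (fun f => place f.1 (ihead f.2)).

End Invasion.

(* Main.v *)
Require Import Defs.
From mathcomp Require Import perm fraction ring zify.

(* All the determinants here are values of eta, by elimination of a Schur
   complement.  Attaching to every edge of G a private copy of a fixed matrix N
   multiplies eta_G by (det N)^|E| and changes its arguments by a substitution
   that depends only on the gadget.  The invaded digraphs are of this form, with
   N the inner part of S; so is the edge matrix I - W of the reversing double,
   with N the 2 x 2 block of an edge and its reverse, and there the substitution
   can be inverted.  Both |E| and eta_G can thus be recovered from det (I - W).
   A two-vertex invader substitutes the entries of -A_S for the last four
   variables of eta_G; a polynomial that vanishes at all negative integers is 0.
   Finally zeta_G is the inverse of det (I - W): with z marking the length, both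
   det (I - z W) and the product of the 1 - w(c) z^l over the primitive cycles
   have constant term 1 and logarithmic derivative - sum_l tr(W^l) z^(l-1), since
   tr(W^l) is the total weight of the circuits of length l, each of which is a
   power of a primitive one. *)

Set Implicit Arguments.
Unset Strict Implicit.
Unset Printing Implicit Defensive.

Import GRing.Theory.
Local Open Scope ring_scope.

(** * Determinants indexed by finite types *)

Section FinTypeMatrices.
Variable R : comNzRingType.
Implicit Types T : finType.

Definition fmx T1 T2 (F : T1 -> T2 -> R) : 'M[R]_(#|T1|, #|T2|) :=
  \matrix_(i, j) F (enum_val i) (enum_val j).

Definition fdet T (F : T -> T -> R) : R := \det (fmx F).

Lemma eq_fmx T1 T2 (F G : T1 -> T2 -> R) : (forall x y, F x y = G x y) -> fmx F = fmx G.
Proof. by move=> e; apply/matrixP => i j; rewrite !mxE. Qed.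

Lemma eq_fdet T (F G : T -> T -> R) : (forall x y, F x y = G x y) -> fdet F = fdet G.
Proof. by move=> e; rewrite /fdet (eq_fmx e). Qed.

Lemma sum_enum_val T (F : T -> R) : \sum_(i < #|T|) F (enum_val i) = \sum_x F x.
Proof. by rewrite (reindex _ (onW_bij _ (enum_val_bij T))). Qed.

Lemma prod_enum_val T (F : T -> R) : \prod_(i < #|T|) F (enum_val i) = \prod_x F x.
Proof. by rewrite (reindex _ (onW_bij _ (enum_val_bij T))). Qed.

Lemma fmx_mul T1 T2 T3 (F : T1 -> T2 -> R) (G : T2 -> T3 -> R) :
  fmx F *m fmx G = fmx (fun x z => \sum_y F x y * G y z).
Proof.
apply/matrixP => i j; rewrite !mxE -[RHS]sum_enum_val.
by apply: eq_bigr => k _; rewrite !mxE.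
Qed.

Lemma fmx_scalar T (a : R) : fmx (fun x y : T => a *+ (x == y)) = a%:M.
Proof. by apply/matrixP => i j; rewrite !mxE (inj_eq enum_val_inj). Qed.

Lemma fmxB T1 T2 (F G : T1 -> T2 -> R) : fmx F - fmx G = fmx (fun x y => F x y - G x y).
Proof. by apply/matrixP => i j; rewrite !mxE. Qed.

(** Rows and columns are rearranged by one and the same permutation, whose sign enters twice and
    cancels. Determinants may therefore be computed in any convenient enumeration. *)
Lemma fdet_ord n T (f : 'I_n -> T) (F : T -> T -> R) :
  bijective f -> fdet F = \det (\matrix_(i, j) F (f i) (f j)).
Proof.
move=> bijf; have := bij_eq_card bijf; rewrite card_ord => nE; subst n.
have injs : injective (enum_rank \o f) by apply: inj_comp (bij_inj bijf); apply: enum_rank_inj.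
pose s := perm injs.
have -> : \matrix_(i, j) F (f i) (f j) = row_perm s (col_perm s (fmx F)).
  by apply/matrixP => i j; rewrite !mxE !permE /= !enum_rankK.
rewrite row_permE col_permE !det_mulmx !det_perm odd_permV -/(fdet F).
by rewrite [fdet F * _]mulrC mulrA -signr_addb addbb mul1r.
Qed.

Lemma fdet_bij T T' (f : T -> T') (F : T' -> T' -> R) :
  bijective f -> fdet F = fdet (fun x y => F (f x) (f y)).
Proof. by move=> bijf; apply: fdet_ord; apply: bij_comp (enum_val_bij T). Qed.

Lemma fdet_sum T1 T2 (F : T1 + T2 -> T1 + T2 -> R) :
  fdet F = \det (block_mx (fmx (fun x y => F (inl x) (inl y)))
                          (fmx (fun x y => F (inl x) (inr y)))
                          (fmx (fun x y => F (inr x) (inl y)))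
                          (fmx (fun x y => F (inr x) (inr y)))).
Proof.
pose f (k : 'I_(#|T1| + #|T2|)) : (T1 + T2)%type :=
  match split k with inl i => inl (enum_val i) | inr j => inr (enum_val j) end.
pose g (x : T1 + T2) : 'I_(#|T1| + #|T2|) :=
  unsplit (match x with inl y => inl (enum_rank y) | inr y => inr (enum_rank y) end).
have bijf : bijective f.
  exists g => [k|x]; rewrite /f /g.
    by rewrite -[RHS](splitK k); case: (split k) => i; rewrite enum_valK.
  by rewrite unsplitK; case: x => y; rewrite enum_rankK.
rewrite (fdet_ord _ bijf); congr (\det _); apply/matrixP => i j.
by rewrite !mxE /f; case: (split i) => i'; rewrite !mxE; case: (split j) => j'; rewrite !mxE.
Qed.

(** Splitting off the copy with index 0 leaves zero off-diagonal blocks, so the determinant is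
    multiplicative over the copies. *)
Lemma fdet_kron_ord n T (N : T -> T -> R) :
  fdet (fun p q : 'I_n * T => N p.2 q.2 *+ (p.1 == q.1)) = fdet N ^+ n.
Proof.
elim: n => [|n IH].
  rewrite /fdet expr0; move: (fmx _).
  have -> : #|{: 'I_0 * T}| = 0%N by rewrite card_prod card_ord.
  by move=> M; apply: det_mx00.
pose f (x : T + 'I_n * T) : 'I_n.+1 * T :=
  match x with inl y => (ord0, y) | inr p => (lift ord0 p.1, p.2) end.
pose g (p : 'I_n.+1 * T) : (T + 'I_n * T)%type :=
  match unlift ord0 p.1 with Some k => inr (k, p.2) | None => inl p.2 end.
have bijf : bijective f.
  exists g => [[y|[k y]]|[k y]]; rewrite /f /g /= ?unlift_none ?liftK //.
  by case: unliftP => [j|] ->.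
rewrite (fdet_bij _ bijf) fdet_sum /=.
have -> : fmx (fun (x : T) (y : 'I_n * T) => N x y.2 *+ (ord0 == lift ord0 y.1)) = 0.
  by apply/matrixP => i j; rewrite !mxE -val_eqE.
rewrite det_lblock exprS -IH; congr (_ * _).
Qed.

Lemma fdet_kron T1 T (N : T -> T -> R) :
  fdet (fun p q : T1 * T => N p.2 q.2 *+ (p.1 == q.1)) = fdet N ^+ #|T1|.
Proof.
have bijf : bijective (fun p : 'I_#|T1| * T => (enum_val p.1, p.2)).
  by exists (fun p => (enum_rank p.1, p.2)) => -[k x] /=; rewrite ?enum_valK ?enum_rankK.
rewrite (fdet_bij _ bijf) -fdet_kron_ord; apply: eq_fdet => p q /=.
by rewrite (inj_eq enum_val_inj).
Qed.

(** Elimination by a factorization into block triangular matrices. The inverse [D'] is an argument,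
    so nothing has to be divided and any commutative ring is allowed. *)
Lemma det_schur m n (A : 'M[R]_m) (B : 'M_(m, n)) (C : 'M_(n, m)) (D D' : 'M_n) :
  D *m D' = 1%:M ->
  \det (block_mx A B C D) = \det D * \det (A - B *m D' *m C).
Proof.
move=> DD'.
have -> : block_mx A B C D
    = block_mx (A - B *m D' *m C) B 0 D *m block_mx 1%:M 0 (D' *m C) 1%:M.
  rewrite mulmx_block !mulmx1 !mulmx0 !add0r mulmxA subrK.
  by rewrite (mulmxA D) DD' mul1mx.
by rewrite det_mulmx det_ublock det_lblock !det1 !mulr1 mulrC.
Qed.

Lemma fdet_schur T1 T2 (F : T1 + T2 -> T1 + T2 -> R) (D' : T2 -> T2 -> R) :
  (forall p q, \sum_r F (inr p) (inr r) * D' r q = 1 *+ (p == q)) ->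
  fdet F = fdet (fun p q => F (inr p) (inr q)) *
    fdet (fun v w => F (inl v) (inl w)
                     - \sum_p \sum_q F (inl v) (inr p) * D' p q * F (inr q) (inl w)).
Proof.
move=> FD'; rewrite fdet_sum (@det_schur _ _ _ _ _ _ (fmx D')); last first.
  by rewrite fmx_mul -fmx_scalar; apply: eq_fmx.
congr (_ * \det _); rewrite !fmx_mul fmxB; apply: eq_fmx => v w; congr (_ - _).
rewrite exchange_big; apply: eq_bigr => p _ /=.
by rewrite mulr_suml.
Qed.

End FinTypeMatrices.

Lemma rmorph_fdet (R S : comNzRingType) (f : {rmorphism R -> S}) (T : finType)
    (F : T -> T -> R) : f (fdet F) = fdet (fun x y => f (F x y)).
Proof.
by rewrite /fdet -det_map_mx; congr (\det _); apply/matrixP => i j; rewrite !mxE.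
Qed.

(** * The generalized characteristic polynomial and gadgets *)

Lemma sum_delta (R : nmodType) (T : finType) (F : T -> R) (a : T) :
  \sum_x F x *+ (a == x) = F a.
Proof.
rewrite (bigD1 a) //= eqxx mulr1n big1 ?addr0 // => x xa.
by rewrite eq_sym (negPf xa).
Qed.

Lemma sum_pair (R : nmodType) (A B : finType) (F : A * B -> R) :
  \sum_p F p = \sum_a \sum_b F (a, b).
Proof. by rewrite pair_bigA; apply: eq_bigr => -[]. Qed.

Lemma sum_bool (R : nmodType) (F : bool -> R) : \sum_b F b = F true + F false.
Proof. by rewrite (bigD1 true) // (bigD1 false) //= big_pred0 ?addr0 // => -[]. Qed.

Lemma mulrb_andr (R : nmodType) (a : R) (b c : bool) : a *+ b *+ c = a *+ (b && c).
Proof. by rewrite -mulrnA mulnb. Qed.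

Lemma mulr_mulrb (R : pzSemiRingType) (a b : R) (c d : bool) :
  a *+ c * (b *+ d) = (a * b) *+ (c && d).
Proof. by rewrite mulrnAl mulrnAr -mulrnA mulnb andbC. Qed.

Lemma sum_delta2 (R : nmodType) (T1 T2 : finType) (c : R) a b (P : pred T1) (P' : pred T2) :
  \sum_i \sum_j c *+ ((a == i) && (b == j)) *+ (P i && P' j) = c *+ (P a && P' b).
Proof.
rewrite -[RHS](sum_delta (fun i => c *+ (P i && P' b))); apply: eq_bigr => i _.
rewrite -[RHS](sum_delta (fun j => c *+ (P i && P' j) *+ (a == i)) b).
by apply: eq_bigr => j _; rewrite !mulrb_andr andbC andbA.
Qed.

Definition endpt (H : digraph) (d : bool) (e : edge H) : vert H :=
  if d then etail e else ehead e.

Section Eta.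
Variable R : comNzRingType.

(** Every edge adds one 2 x 2 matrix [Q] on its two ends: the (tail, tail) terms sum to D^out,
    (head, head) to D^in, (tail, head) to A and (head, tail) to A^T. In this shape an elimination
    local to each edge changes [Q] only. *)
Definition edge_form (H : digraph) (Q : bool -> bool -> R) (v w : vert H) : R :=
  \sum_e \sum_d \sum_d' Q d d' *+ ((endpt d e == v) && (endpt d' e == w)).

(* [geta H x Q] is eta_H at (x, Q true true, Q false false, Q true false,
   Q false true). *)
Definition geta (H : digraph) (x : R) (Q : bool -> bool -> R) : R :=
  fdet (fun v w : vert H => x *+ (v == w) + edge_form Q v w).

Lemma eq_edge_form H (Q Q' : bool -> bool -> R) :
  (forall d d', Q d d' = Q' d d') -> forall v w : vert H, edge_form Q v w = edge_form Q' v w.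
Proof.
by move=> e v w; do 3 (apply: eq_bigr => ? _); rewrite e.
Qed.

Lemma eq_geta H x (Q Q' : bool -> bool -> R) :
  (forall d d', Q d d' = Q' d d') -> geta H x Q = geta H x Q'.
Proof. by move=> e; apply: eq_fdet => v w; rewrite (eq_edge_form e). Qed.

Section Gadget.
Variables (G : digraph) (I : finType).
Variables (x : R) (Q : bool -> bool -> R) (a : bool -> I -> R) (b : I -> bool -> R).
Variables (N N' : I -> I -> R).

(* Each edge of [G] carries a private copy of [I], coupled to its two ends by
   [a] and [b]. *)
Definition gadget_form (p q : (vert G + edge G * I)%type) : R :=
  match p, q with
  | inl v, inl w => x *+ (v == w) + edge_form Q v w
  | inl v, inr q => \sum_d a d q.2 *+ (endpt d q.1 == v)
  | inr p, inl w => \sum_d b p.2 d *+ (endpt d p.1 == w)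
  | inr p, inr q => N p.2 q.2 *+ (p.1 == q.1)
  end.

Let sum_fst (F : edge G * I -> R) e : \sum_q F q *+ (e == q.1) = \sum_j F (e, j).
Proof.
rewrite sum_pair exchange_big; apply: eq_bigr => j _ /=.
by rewrite (sum_delta (fun e' => F (e', j))).
Qed.

(** The private indices of all edges are eliminated at once. Their block is block diagonal with
    blocks [N], which gives the power of [fdet N]; its inverse has blocks [N'], so the correction
    term only links ends of the same edge and is again an edge form. *)
Lemma fdet_gadget :
  (forall i j, \sum_k N i k * N' k j = 1 *+ (i == j)) ->
  fdet gadget_form = fdet N ^+ #|edge G| *
    geta G x (fun d d' => Q d d' - \sum_i \sum_j a d i * N' i j * b j d').
Proof.
move=> NN'.
have prod3 (f g : bool -> R) (n : R) :
    (\sum_d f d) * n * (\sum_d g d) = \sum_d \sum_d' f d * n * g d'.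
  by rewrite mulr_suml mulr_suml; apply: eq_bigr => d _; rewrite mulr_sumr.
rewrite (@fdet_schur _ _ _ _ (fun p q => N' p.2 q.2 *+ (p.1 == q.1))).
  rewrite /= fdet_kron; congr (_ * _); apply: eq_fdet => v w /=.
  rewrite -addrA; congr (_ + _).
  rewrite [X in _ - X]sum_pair /=.
  rewrite /edge_form -sumrB; apply: eq_bigr => e _.
  (* The delta in the inverse forces the second edge to be [e]. What follows moves the sums over the
     ends outside those over [I] and compares the terms one by one. *)
  under [X in _ - X]eq_bigr => i _.
    under eq_bigr => q _ do rewrite mulrnAr mulrnAl.
    rewrite (sum_fst (fun q => (\sum_d a d i *+ (endpt d e == v)) * N' i q.2
      * (\sum_d b q.2 d *+ (endpt d q.1 == w)))) /=.
  over.
  under [X in _ - X]eq_bigr => i _.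
    under eq_bigr => j _.
      rewrite prod3.
    over.
  over.
  under [X in _ - X]eq_bigr => i _ do rewrite exchange_big /=.
  rewrite [X in _ - X]exchange_big /= -sumrB; apply: eq_bigr => d _.
  under [X in _ - X]eq_bigr => i _ do rewrite exchange_big /=.
  rewrite [X in _ - X]exchange_big /= -sumrB; apply: eq_bigr => d' _.
  rewrite mulrnBl; congr (_ - _).
  rewrite -sumrMnl; apply: eq_bigr => i _.
  rewrite -sumrMnl; apply: eq_bigr => j _.
  by rewrite mulrnAl mulr_mulrb.
move=> [e i] [e' j] /=.
under eq_bigr => r _ do rewrite mulrnAl.
rewrite (sum_fst (fun r => N i r.2 * (N' r.2 j *+ (r.1 == e')))) /=.
under eq_bigr => k _ do rewrite mulrnAr.
by rewrite sumrMnl NN' mulrb_andr andbC.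
Qed.

End Gadget.

Section Invasion.
Variables (S : invader) (G : digraph).

Definition native (d : bool) : vert S := if d then ord0 else ord_max.

Lemma place_native e d : @place S G e (native d) = inl (endpt d e).
Proof. by rewrite /place insubF; case: d => //=; rewrite eqxx ?andbF. Qed.

Lemma place_inner e (i : inner_vert S) : @place S G e (val i) = inr (e, i).
Proof. by rewrite /place valK. Qed.

Lemma sum_native_inner (F : vert S -> R) :
  \sum_i F i = \sum_d F (native d) + \sum_(i : inner_vert S) F (val i).
Proof.
rewrite (bigID (fun i : 'I_(ninner S).+2 => (i != ord0) && (i != ord_max))) /= addrC.
congr (_ + _).
  rewrite sum_bool (bigD1 ord0) //= (bigD1 ord_max) ?eqxx //= big1 ?addr0 // => i.
  by case: (i == ord0); case: (i == ord_max).
rewrite (reindex_omap (val : inner_vert S -> _) insub) => [|i Pi]; last by rewrite insubT.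
by apply: eq_bigl => i; rewrite valK eqxx andbT (valP i).
Qed.

Variables (x : R) (Q : bool -> bool -> R).

(** For a fixed edge [e] of G, the copy of S contributes the form of S pushed forward along
    [place e]. *)
Lemma edge_form_invaded (v w : vert (invaded S G)) :
  edge_form Q v w =
  \sum_e \sum_i \sum_j edge_form (H := S) Q i j *+ ((place e i == v) && (place e j == w)).
Proof.
rewrite /edge_form sum_pair /=.
apply: eq_bigr => e _.
have endptE d f : endpt (H := invaded S G) d (e, f) = place e (endpt (H := S) d f).
  by case: d.
under [RHS]eq_bigr => i _ do under eq_bigr => j _ do rewrite -sumrMnl.
under [RHS]eq_bigr => i _ do rewrite exchange_big /=.
rewrite [RHS]exchange_big /=; apply: eq_bigr => f _.
under [RHS]eq_bigr => i _ do under eq_bigr => j _ do rewrite -sumrMnl.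
under [RHS]eq_bigr => i _ do rewrite exchange_big /=.
rewrite [RHS]exchange_big /=; apply: eq_bigr => d _.
under [RHS]eq_bigr => i _ do under eq_bigr => j _ do rewrite -sumrMnl.
under [RHS]eq_bigr => i _ do rewrite exchange_big /=.
rewrite [RHS]exchange_big /=; apply: eq_bigr => d' _.
rewrite !endptE.
by rewrite sum_delta2.
Qed.

Let L i j := edge_form (H := S) Q i j.

(* The part of an invaded digraph lying on one copy of [S] is a gadget. *)
Lemma geta_invaded (N' : inner_vert S -> inner_vert S -> R) :
  let N i j := x *+ (i == j) + L (val i) (val j) in
  (forall i j, \sum_k N i k * N' k j = 1 *+ (i == j)) ->
  geta (invaded S G) x Q = fdet N ^+ #|edge G| *
    geta G x (fun d d' => L (native d) (native d')
      - \sum_i \sum_j L (native d) (val i) * N' i j * L (val j) (native d')).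
Proof.
move=> N NN'; rewrite -(@fdet_gadget _ _ _ _ (fun d i => L (native d) (val i))
  (fun i d => L (val i) (native d)) N N') //.
apply: eq_fdet => v w; rewrite edge_form_invaded.
have zero (T1 T2 : finType) (c : T1 -> T2 -> R) :
    (forall i j, c i j = 0) -> \sum_i \sum_j c i j = 0.
  by move=> c0; apply: big1 => i _; apply: big1 => j _; apply: c0.
have inrE e0 i0 e i : (inr (e0, i0) == inr (e, i) :> vert (invaded S G)) = (e == e0) && (i == i0).
  by apply/eqP/andP => [[-> ->]|[/eqP-> /eqP->]].
have split_sum (c : vert S -> vert S -> R) : \sum_i \sum_j c i j
    = \sum_d \sum_d' c (native d) (native d') + \sum_d \sum_(j : inner_vert S) c (native d) (val j)
    + (\sum_(i : inner_vert S) \sum_d c (val i) (native d)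
       + \sum_(i : inner_vert S) \sum_(j : inner_vert S) c (val i) (val j)).
  by rewrite sum_native_inner -!big_split; congr (_ + _); apply: eq_bigr => i _;
    rewrite sum_native_inner.
under eq_bigr => e _.
  rewrite split_sum.
  under eq_bigr => d _ do under eq_bigr => d' _ do rewrite !place_native.
  under [X in _ + X + _]eq_bigr => d _ do under eq_bigr => j _ do rewrite place_native place_inner.
  under [X in _ + (X + _)]eq_bigr => i _ do
    under eq_bigr => d _ do rewrite place_native place_inner.
  under [X in _ + (_ + X)]eq_bigr => i _ do under eq_bigr => j _ do rewrite !place_inner.
over.
(* The four cases are the four blocks of [gadget_form]. In each, exactly one of the four parts of
   [split_sum] survives, since a native position lands in G and an inner one in a copy. *)
case: v w => [v|[e i]] [w|[e' j]] /=.
- congr (_ + _); apply: eq_bigr => e _.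
  rewrite [X in _ + X + _]zero => [|d j]; last by rewrite andbF.
  by rewrite [X in _ + (X + _)]zero // [X in _ + (_ + X)]zero // !addr0.
- rewrite add0r -(sum_delta (fun e => \sum_d L (native d) (val j) *+ (endpt d e == v))).
  apply: eq_bigr => e _.
  rewrite zero => [|d d']; last by rewrite andbF.
  rewrite [X in _ + (X + _)]zero // [X in _ + (_ + X)]zero // !addr0 add0r.
  rewrite -sumrMnl; apply: eq_bigr => d _.
  rewrite -[RHS](sum_delta (fun j0 => L (native d) (val j0) *+ (endpt d e == v) *+ (e' == e))).
  by apply: eq_bigr => j0 _; rewrite inrE !mulrb_andr andbA.
- rewrite add0r -(sum_delta (fun e => \sum_d L (val i) (native d) *+ (endpt d e == w)) e).
  apply: eq_bigr => e0 _.
  rewrite zero // [X in _ + X + _]zero // [X in _ + (_ + X)]zero ?addr0 ?add0r; last first.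
    by move=> i0 j; rewrite andbF.
  rewrite exchange_big -sumrMnl; apply: eq_bigr => d _ /=.
  rewrite -[RHS](sum_delta (fun i0 => L (val i0) (native d) *+ (endpt d e0 == w) *+ (e == e0))).
  by apply: eq_bigr => i0 _; rewrite inrE !mulrb_andr andbC andbA.
- rewrite inrE mulrnDl mulrb_andr (eq_sym e') (eq_sym j) andbC; congr (_ + _).
  rewrite -(sum_delta (fun e0 => L (val i) (val j) *+ (e == e0)) e').
  apply: eq_bigr => e0 _.
  rewrite zero // [X in _ + X + _]zero // [X in _ + (X + _)]zero ?add0r; last first.
    by move=> i0 d; rewrite andbF.
  rewrite mulrb_andr -[RHS](sum_delta (fun i0 => L (val i0) (val j) *+ ((e == e0) && (e' == e0)))).
  apply: eq_bigr => i0 _.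
  rewrite -(sum_delta (fun j0 => L (val i0) (val j0) *+ ((e == e0) && (e' == e0))) j) -sumrMnl.
  by apply: eq_bigr => j0 _; rewrite !inrE !mulrb_andr andbACA (andbC (i == i0)) andbA.
Qed.


End Invasion.

Definition quad (y z a b : R) (d d' : bool) : R :=
  if d then if d' then y else a else if d' then b else z.

Lemma det_geta H (A : 'M[R]_#|vert H|) x y z a b :
  (forall i j, A i j =
     #|[set e : edge H | (etail e == enum_val i) && (ehead e == enum_val j)]|%:R) ->
  \det (x%:M + y *: rowsum_mx A + z *: rowsum_mx A^T + a *: A + b *: A^T)
    = geta H x (quad y z a b).
Proof.
move=> AE.
have {}AE i j : A i j = \sum_e 1 *+ ((etail e == enum_val i) && (ehead e == enum_val j)).
  by rewrite AE -sum1_card natr_sum big_mkcond; apply: eq_bigr => e _; rewrite inE; case: ifP.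
have sum1 (f : edge H -> vert H) e : \sum_(j < #|vert H|) 1 *+ (f e == enum_val j) = 1 :> R.
  rewrite (sum_enum_val (fun j => 1 *+ (f e == j))).
  exact: (sum_delta (fun=> 1)).
rewrite /geta /fdet; congr (\det _); apply/matrixP => i j; rewrite !mxE.
set v := enum_val i; set w := enum_val j.
have ij : (i == j) = (v == w) by rewrite (inj_eq enum_val_inj).
have -> : \sum_k A i k = \sum_e 1 *+ (etail e == v).
  under eq_bigr => k _ do rewrite AE.
  rewrite exchange_big; apply: eq_bigr => e _ /=.
  under eq_bigr => k _ do rewrite andbC -mulrb_andr.
  by rewrite sumrMnl sum1.
have -> : \sum_k A^T i k = \sum_e 1 *+ (ehead e == v).
  under eq_bigr => k _ do rewrite mxE AE.
  rewrite exchange_big; apply: eq_bigr => e _ /=.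
  under eq_bigr => k _ do rewrite -mulrb_andr.
  by rewrite sumrMnl sum1.
rewrite !AE -/v -/w ij -!addrA; congr (_ + _).
rewrite -!sumrMnl !mulr_sumr -!big_split; apply: eq_bigr => e _ /=.
rewrite !sum_bool /quad /endpt /= !mulrb_andr !mulrnAr !mulr1.
(* An end paired with itself contributes on the diagonal only; this is how the degree matrices come
   out of the edge form. *)
have andb_eq (u : vert H) : (u == v) && (u == w) = (u == v) && (v == w).
  by case: eqP => // ->.
rewrite !andb_eq (andbC (etail e == w)).
move: (y *+ _) (z *+ _) (a *+ _) (b *+ _) => c1 c2 c3 c4; ring.
Qed.

End Eta.

Lemma rmorph_edge_form (R S : comNzRingType) (f : {rmorphism R -> S}) H Q (v w : vert H) :
  f (edge_form Q v w) = edge_form (fun d d' => f (Q d d')) v w.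
Proof.
rewrite rmorph_sum; apply: eq_bigr => e _; rewrite rmorph_sum.
apply: eq_bigr => d _; rewrite rmorph_sum; apply: eq_bigr => d' _.
by rewrite rmorphMn.
Qed.

Lemma rmorph_geta (R S : comNzRingType) (f : {rmorphism R -> S}) H x Q :
  f (geta H x Q) = geta H (f x) (fun d d' => f (Q d d')).
Proof.
rewrite rmorph_fdet; apply: eq_fdet => v w.
by rewrite rmorphD rmorphMn rmorph_edge_form.
Qed.

Lemma eta_geta H : eta H =
  geta H 'X_(@Ordinal 5 0 isT) (quad 'X_(@Ordinal 5 1 isT) 'X_(@Ordinal 5 2 isT)
    'X_(@Ordinal 5 3 isT) 'X_(@Ordinal 5 4 isT)).
Proof. by apply: det_geta => i j; rewrite !mxE -[RHS](rmorph_nat (@mpolyC 5 int)) natz. Qed.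

Lemma chi_geta H : chi H = geta H 'X (quad 0 0 (-1) 0).
Proof.
rewrite -(@det_geta _ _ (map_mx polyC (adj_mx H))) => [|i j]; last first.
  by rewrite !mxE -[RHS](rmorph_nat (@polyC int)) natz.
by rewrite !scale0r !addr0 scaleN1r.
Qed.

Lemma eq_geta_quad (R : comNzRingType) H (x : R) Q :
  geta H x Q = geta H x (quad (Q true true) (Q false false) (Q true false) (Q false true)).
Proof. by apply: eq_geta => -[] []. Qed.

(** The variables of [eta] are generic, so every [geta] over every commutative ring is a
    specialization of it, by a morphism that does not depend on the digraph. *)
Lemma eta_eval (R : comNzRingType) (x y z a b : R) :
  exists f : {rmorphism {mpoly int[5]} -> R}, forall H, f (eta H) = geta H x (quad y z a b).
Proof.
pose h := nth 0 [:: x; y; z; a; b].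
exists (mmap intr h) => H; rewrite eta_geta rmorph_geta /= !mmapX !mmap1U.
by rewrite eq_geta_quad /= !mmapX !mmap1U.
Qed.

Lemma eta_eq_geta H H' : eta H = eta H' -> forall (R : comNzRingType) (x : R) Q,
  geta H x Q = geta H' x Q.
Proof.
move=> e R x Q.
have [f fE] := eta_eval x (Q true true) (Q false false) (Q true false) (Q false true).
by rewrite eq_geta_quad [RHS]eq_geta_quad -!fE e.
Qed.

(** * Invaded digraphs *)

Lemma fdet_diag (R : comNzRingType) (T : finType) (D : T -> R) :
  fdet (fun x y => D x *+ (x == y)) = \prod_x D x.
Proof.
rewrite -prod_enum_val /fdet.
have -> : fmx (fun x y => D x *+ (x == y)) = diag_mx (\row_i D (enum_val i)).
  by apply/matrixP => i j; rewrite !mxE (inj_eq enum_val_inj).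
by rewrite det_diag; apply: eq_bigr => i _; rewrite mxE.
Qed.

Lemma fdet_card0 (R : comNzRingType) (T : finType) (F : T -> T -> R) :
  #|T| = 0%N -> fdet F = 1.
Proof. by rewrite /fdet; move: (fmx F) => M T0; move: M; rewrite T0 => M; apply: det_mx00. Qed.

Lemma fdet_inv (K : fieldType) (T : finType) (N : T -> T -> K) : fdet N != 0 ->
  exists N', forall x y, \sum_z N x z * N' z y = 1 *+ (x == y).
Proof.
move=> N0; have uN : fmx N \in unitmx by rewrite unitmxE unitfE.
exists (fun x y => invmx (fmx N) (enum_rank x) (enum_rank y)) => x y.
have /matrixP/(_ (enum_rank x) (enum_rank y)) := mulmxV uN.
rewrite !mxE (inj_eq enum_rank_inj) => <-.
rewrite -sum_enum_val; apply: eq_bigr => z _.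
by rewrite mxE enum_rankK enum_valK.
Qed.

(** With only D^out left the matrix is diagonal, with entries 1 + outdeg(v) X. The linear
    coefficient of the product is the sum of the out-degrees. *)
Lemma geta_card_edge H : (geta H 1 (quad 'X 0 0 0) : {poly int})`_1 = #|edge H|%:R.
Proof.
have -> : geta H 1 (quad 'X 0 0 0)
    = \prod_v (1 + 'X *+ #|[set e : edge H | etail e == v]|) :> {poly int}.
  rewrite -fdet_diag; apply: eq_fdet => v w.
  rewrite mulrnDl; congr (_ + _).
  rewrite -sum1_card -sumrMnr -sumrMnl big_mkcond; apply: eq_bigr => e _.
  rewrite !sum_bool /quad /endpt /= !mul0rn !addr0 inE -mulrb_andr mulr1n.
  by case: (etail e =P v) => [->|_]; rewrite ?mul0rn ?eqxx ?mulr1n.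
have -> : #|edge H|%:R = \sum_v #|[set e : edge H | etail e == v]|%:R :> int.
  rewrite -natr_sum -sum1_card (partition_big (@etail H) predT) //=.
  by congr (_%:R); apply: eq_bigr => v _; rewrite -sum1_card; apply: eq_bigl => e; rewrite inE.
(* The constant coefficient is carried along because the induction for the linear one needs it. *)
suff [] : (\prod_v (1 + 'X *+ #|[set e : edge H | etail e == v]|) : {poly int})`_0 = 1 /\
  (\prod_v (1 + 'X *+ #|[set e : edge H | etail e == v]|) : {poly int})`_1 =
    \sum_v #|[set e : edge H | etail e == v]|%:R by [].
elim/big_rec2: _ => [|v p s _ [p0 p1]]; first by rewrite !coef1.
rewrite mulrDl mul1r mulrnAl !coefD !coefMn !coefXM /= p0 p1.
by rewrite mul0rn addr0 addrC.
Qed.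

Lemma eta_card_edge G G' : eta G = eta G' -> #|edge G| = #|edge G'|.
Proof.
move=> e; have := geta_card_edge G.
rewrite (eta_eq_geta e) geta_card_edge => /eqP.
by rewrite !natz => /eqP[].
Qed.

(** Over the fraction field the inner block of S can be inverted. [geta_invaded] then writes both
    sides through the number of edges and the values of [geta] at one common argument, and [eta]
    determines both. *)
Lemma eta_invaded G G' (S : invader) : eta G = eta G' -> eta (invaded S G) = eta (invaded S G').
Proof.
move=> e; have em := eta_card_edge e.
rewrite !eta_geta; set x := 'X_ _; set Q := quad _ _ _ _.
apply/eqP; rewrite -tofrac_eq !rmorph_geta; apply/eqP => /=.
set Q' := fun d d' => _.
pose N0 (i j : inner_vert S) := x *+ (i == j) + edge_form (H := S) Q (val i) (val j).
pose N (i j : inner_vert S) := tofrac x *+ (i == j) + edge_form (H := S) Q' (val i) (val j).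
have NE i j : N i j = tofrac (N0 i j).
  by rewrite rmorphD rmorphMn rmorph_edge_form.
have : fdet N != 0.
  rewrite (eq_fdet NE) -rmorph_fdet tofrac_eq0.
  (* The inner determinant is nonzero: keeping x and sending the other variables to 0 turns it into
     a power of X. *)
  pose h := nth 0 [:: 'X; 0; 0; 0; 0 : {poly int}].
  apply/eqP => /(congr1 (mmap intr h)); rewrite rmorph0 rmorph_fdet.
  rewrite (@eq_fdet _ _ _ (fun i j => 'X *+ (i == j))) ?fdet_diag => [|i j].
    by rewrite prodr_const => /eqP; rewrite expf_eq0 polyX_eq0 andbF.
  rewrite rmorphD rmorphMn rmorph_edge_form /= mmapX mmap1U.
  rewrite /edge_form big1 ?addr0 // => f _.
  by rewrite big1 // => d _; rewrite big1 // => d' _; case: d; case: d';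
    rewrite /= mmapX mmap1U mul0rn.
case/fdet_inv=> N' NN'.
by rewrite !(geta_invaded _ NN') em (eta_eq_geta e).
Qed.

Lemma eta_eq_chi H H' : eta H = eta H' -> chi H = chi H'.
Proof. by move=> e; rewrite !chi_geta; apply: eta_eq_geta. Qed.

(** * Invaders with two vertices *)

Section TwoVertexInvaders.
Variable c : bool -> bool -> nat.

(** The successor in the multiplicities makes all four entries of the adjacency matrix positive for
    every [c]. *)
Definition two_vertex_invader : invader :=
  @Invader 0 {p : bool * bool & 'I_(c p.1 p.2).+1}
    (fun f => if (tag f).1 then ord0 else ord_max)
    (fun f => if (tag f).2 then ord0 else ord_max).
Local Notation S := two_vertex_invader.

Lemma two_vertex_card : #|vert S| = 2%N.
Proof. exact: card_ord. Qed.

Lemma two_vertex_nativeP (i : vert S) : exists d, i = native S d.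
Proof.
by case: i => -[|[|//]] h; [exists true | exists false]; apply: val_inj.
Qed.

Lemma two_vertex_native_eq d d' : (native S d == native S d') = (d == d').
Proof. by case: d; case: d'. Qed.

Lemma two_vertex_mult d d' :
  #|[set f : edge S | (etail f == native S d) && (ehead f == native S d')]| = (c d d').+1.
Proof.
rewrite -[RHS](card_ord (c d d').+1).
have injt : injective (fun k =>
    Tagged (fun p : bool * bool => 'I_(c p.1 p.2).+1) (k : 'I_(c (d,d').1 (d,d').2).+1)).
  by move=> k k' /eqP; rewrite eq_Tagged => /eqP.
rewrite -(card_imset _ injt) /=; apply: eq_card => -[[a b] k]; rewrite inE /=.
have -> : (if a then ord0 else ord_max) = native S a by [].
have -> : (if b then ord0 else ord_max) = native S b by [].
rewrite !two_vertex_native_eq.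
apply/andP/imsetP => [[/eqP e1 /eqP e2]|[k' _ /(congr1 tag) [-> ->]]]; last by [].
by subst; exists k.
Qed.

Lemma two_vertex_pos (i j : 'I_#|vert S|) : (0 < adj_mx S i j)%R.
Proof.
rewrite mxE; have [d ->] := two_vertex_nativeP (enum_val i).
by have [d' ->] := two_vertex_nativeP (enum_val j); rewrite two_vertex_mult.
Qed.

(** There is no inner vertex, so the inner determinant is empty and the correction sum vanishes.
    What remains is the form of S on its native vertices, with coefficient -1 on A: the entries of
    -A_S. *)
Lemma chi_two_vertex G : chi (invaded S G) = geta G 'X (fun d d' => - (c d d').+1%:R).
Proof.
have no_inner (i : inner_vert S) : False.
  by case: i => -[[|[|//]] h].
have inner0 : #|{: inner_vert S}| = 0%N by apply: eq_card0 => i; case: (no_inner i).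
rewrite chi_geta (@geta_invaded _ _ _ _ _ (fun _ _ => 0)) => [|i]; last by case: (no_inner i).
rewrite fdet_card0 // expr1n mul1r; apply: eq_geta => d d'.
rewrite [X in _ - X]big1 ?subr0 => [|i]; last by case: (no_inner i).
rewrite -two_vertex_mult -sum1_card natr_sum -sumrN big_mkcond; apply: eq_bigr => f _.
rewrite !sum_bool /quad /endpt /= !mul0rn !addr0 add0r inE.
by case: (_ && _).
Qed.

End TwoVertexInvaders.

(** * Interpolation at the negative integers *)

Section Interpolation.
Variable R : idomainType.
Hypothesis char0 : forall n, n.+1%:R != 0 :> R.

Lemma natr_inj_char0 : injective (fun n => n%:R : R).
Proof.
suff le m n : (m <= n)%N -> m%:R = n%:R :> R -> m = n.
  move=> m n e; case/orP: (leq_total m n) => h; first exact: le.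
  by apply: esym; apply: le => //; rewrite e.
move=> mn e; apply/eqP; rewrite eqn_leq mn /=; case: leqP => // lt.
have := char0 (n - m).-1; rewrite prednK ?subn_gt0 //.
by rewrite natrB // e subrr eqxx.
Qed.

(** In characteristic 0 the first [size p] negative integers are distinct, and a nonzero [p] has
    fewer roots than that. *)
Lemma poly_eq0_neg_nat (p : {poly R}) : (forall n, p.[- n.+1%:R] = 0) -> p = 0.
Proof.
move=> p0; apply/eqP/negPn/negP => /max_poly_roots.
move=> /(_ [seq - n.+1%:R | n <- iota 0 (size p)]).
rewrite size_map size_iota ltnn => h.
apply: notF; apply: h.
  by apply/allP => _ /mapP[n _ ->]; apply/eqP.
rewrite map_inj_uniq ?iota_uniq // => m n /oppr_inj/natr_inj_char0.
by case.
Qed.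

(** Both sides are values at [y] of fixed polynomials, which agree at all negative integers. *)
Lemma geta_interpolate G G' (x : R) (P : bool -> bool -> {poly R}) :
  (forall n, geta G x (fun d d' => (P d d').[- n.+1%:R])
           = geta G' x (fun d d' => (P d d').[- n.+1%:R])) ->
  forall y, geta G x (fun d d' => (P d d').[y]) = geta G' x (fun d d' => (P d d').[y]).
Proof.
have evalE H y : geta H x (fun d d' => (P d d').[y]) = (geta H x%:P P).[y].
  by rewrite -[RHS]/(horner_eval y _) rmorph_geta /= /horner_eval hornerC.
move=> h y; rewrite !evalE; congr (_.[y]); apply/eqP; rewrite -subr_eq0; apply/eqP.
by apply: poly_eq0_neg_nat => n; rewrite hornerD hornerN -!evalE h subrr.
Qed.

Lemma geta_eq_of_negnat G G' (x : R) :
  (forall c : bool -> bool -> nat, geta G x (fun d d' => - (c d d').+1%:R)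
     = geta G' x (fun d d' => - (c d d').+1%:R)) ->
  forall Q, geta G x Q = geta G' x Q.
Proof.
move=> h0.
have {}h0 k l m n : geta G x (quad (- k.+1%:R) (- l.+1%:R) (- m.+1%:R) (- n.+1%:R))
    = geta G' x (quad (- k.+1%:R) (- l.+1%:R) (- m.+1%:R) (- n.+1%:R)).
  rewrite !(@eq_geta _ _ x (quad _ _ _ _) (fun d d' =>
    - ((if d then if d' then k else m else if d' then n else l).+1%:R))) //;
    by case=> -[].
(* The four arguments are freed one after the other: the current one becomes the variable of a
   polynomial in which the others are constants. *)
have step (P : R -> bool -> bool -> R) (P' : bool -> bool -> {poly R}) :
    (forall y d d', P y d d' = (P' d d').[y]) ->
    (forall n, geta G x (P (- n.+1%:R)) = geta G' x (P (- n.+1%:R))) ->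
    forall y, geta G x (P y) = geta G' x (P y).
  move=> PE hP y; rewrite !(eq_geta _ _ (PE y)); apply: geta_interpolate => n.
  by rewrite -!(eq_geta _ _ (PE _)).
have h1 y l m n : geta G x (quad y (- l.+1%:R) (- m.+1%:R) (- n.+1%:R))
    = geta G' x (quad y (- l.+1%:R) (- m.+1%:R) (- n.+1%:R)).
  apply: (step (fun y => quad y _ _ _) (quad 'X (_%:P) (_%:P) (_%:P))) => // {}y d d'.
  by case: d; case: d'; rewrite /= ?hornerX ?hornerC.
have h2 y z m n : geta G x (quad y z (- m.+1%:R) (- n.+1%:R))
    = geta G' x (quad y z (- m.+1%:R) (- n.+1%:R)).
  apply: (step (fun z => quad y z _ _) (quad (y%:P) 'X (_%:P) (_%:P))) => // {}z d d'.
  by case: d; case: d'; rewrite /= ?hornerX ?hornerC.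
have h3 y z a n : geta G x (quad y z a (- n.+1%:R)) = geta G' x (quad y z a (- n.+1%:R)).
  apply: (step (fun a => quad y z a _) (quad (y%:P) (z%:P) 'X (_%:P))) => // {}a d d'.
  by case: d; case: d'; rewrite /= ?hornerX ?hornerC.
have h4 y z a b : geta G x (quad y z a b) = geta G' x (quad y z a b).
  apply: (step (fun b => quad y z a b) (quad (y%:P) (z%:P) (a%:P) 'X)) => // {}b d d'.
  by case: d; case: d'; rewrite /= ?hornerX ?hornerC.
by move=> Q; rewrite eq_geta_quad [RHS]eq_geta_quad.
Qed.

End Interpolation.

Lemma mpoly_char0 n (R : nzRingType) :
  (forall k, k.+1%:R != 0 :> R) -> forall k, k.+1%:R != 0 :> {mpoly R[n]}.
Proof. by move=> R0 k; rewrite -(rmorph_nat (@mpolyC n R)) mpolyC_eq0. Qed.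

Lemma int_char0 k : k.+1%:R != 0 :> int.
Proof. by rewrite natz. Qed.

Lemma eta_of_two_vertex G G' :
  (forall S : invader, #|vert S| = 2%N -> (forall i j, (0 < adj_mx S i j)%R) ->
     chi (invaded S G) = chi (invaded S G')) ->
  eta G = eta G'.
Proof.
move=> h; rewrite !eta_geta.
apply: (geta_eq_of_negnat (mpoly_char0 5 int_char0)) => c.
have := h _ (two_vertex_card c) (two_vertex_pos (c := c)); rewrite !chi_two_vertex.
set x := 'X_ _.
(* The identity in Z[X] is carried into the ring of [eta] by substituting its first variable for X;
   the integer arguments are unaffected. *)
move=> /(congr1 (map_poly intr))/(congr1 (horner_eval x)).
rewrite !rmorph_geta /= map_polyX /horner_eval hornerX => e.
have cE d d' : - (c d d').+1%:R = (map_poly intr (- (c d d').+1%:R : {poly int})).[x].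
  by rewrite rmorphN rmorph_nat hornerN -polyC_natr hornerC.
by rewrite !(eq_geta _ _ cE).
Qed.

(** * The edge matrix of the reversing double *)

Lemma fdet_bool (R : comNzRingType) (F : bool -> bool -> R) :
  fdet F = F true true * F false false - F true false * F false true.
Proof.
have bijf : bijective (fun i : 'I_2 => i == ord0).
  exists (fun b : bool => if b then ord0 else ord_max) => [i|[]] //.
  by case: i => -[|[|//]] h; apply: val_inj.
rewrite (fdet_ord _ bijf) (expand_det_row _ ord0) !big_ord_recl big_ord0.
rewrite /cofactor !det_mx11 !mxE /= !addr0 !expr1 expr0 mul1r mulN1r mulrN.
by [].
Qed.

Section ReversingDeterminant.
Variables (R : comNzRingType) (t u : bool -> R).

(* Here [e.2] is the direction, true for up.  For a simple digraph, the products
   of these weights around the circuits of the reversing double are the weights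
   of the reversing zeta function. *)
Definition rev_weight G (e e' : edge (reversing_double G)) : R :=
  u e.2 * (1 *+ (ehead e == etail e')
           + (t e.2 - 1) *+ ((e.1 == e'.1) && (e.2 != e'.2))).

Definition rev_det G : R :=
  fdet (fun e e' : edge (reversing_double G) => 1 *+ (e == e') - rev_weight e e').

(** Elimination of the first index set instead of the second. Together with [fdet_gadget] it
    evaluates one determinant in two ways, once over edges and once over vertices. *)
Lemma fdet_schur_one (T1 T2 : finType) (F : T1 + T2 -> T1 + T2 -> R) :
  (forall v w, F (inl v) (inl w) = 1 *+ (v == w)) ->
  fdet F = fdet (fun p q => F (inr p) (inr q) - \sum_v F (inr p) (inl v) * F (inl v) (inr q)).
Proof.
move=> F1.
pose sw (T T' : Type) (x : T + T') : (T' + T)%type :=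
  match x with inl y => inr y | inr y => inl y end.
have bijf : bijective (@sw T2 T1) by exists (@sw T1 T2) => -[].
rewrite (fdet_bij _ bijf) (@fdet_schur _ _ _ _ (fun v w => 1 *+ (v == w))) /=; last first.
  move=> p q; under eq_bigr => r _ do rewrite F1 mulr_mulrb mulr1.
  under eq_bigr => r _ do rewrite -mulrb_andr.
  by rewrite -[RHS](sum_delta (fun r => 1 *+ (r == q)) p);
    apply: eq_bigr => r _; rewrite !mulrb_andr andbC.
rewrite (eq_fdet F1) [fdet (fun v w => _)]/fdet fmx_scalar det1 mul1r.
apply: eq_fdet => p q; congr (_ - _); apply: eq_bigr => v _.
rewrite -[RHS](sum_delta (fun w => F (inr p) (inl v) * F (inl w) (inr q))).
by apply: eq_bigr => w _; rewrite mulrnAr mulr1 mulrnAl.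
Qed.

(** The relation that one edge ends where the next begins factors through the vertices. So I - W is
    what remains after the vertices are eliminated from a gadget matrix in which [a] attaches each
    edge of the double to its tail and [b] to its head. *)
Lemma rev_det_gadget G : rev_det G =
  fdet (@gadget_form _ G _ 1 (fun _ _ => 0) (fun d i => 1 *+ (d == i))
    (fun i d => u i *+ (d != i)) (fun i j => 1 *+ (i == j) - (u i * (t i - 1)) *+ (i != j))).
Proof.
rewrite fdet_schur_one => [|v w] /=; last first.
  by rewrite /edge_form big1 ?addr0 // => e _; do 2 (rewrite big1 // => ? _); rewrite mul0rn.
apply: eq_fdet => -[e i] [e' j] /=.
have -> : \sum_v (\sum_d u i *+ (d != i) *+ (endpt d e == v))
      * (\sum_d 1 *+ (d == j) *+ (endpt d e' == v))
    = u i *+ (endpt (~~ i) e == endpt j e').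
  rewrite -(sum_delta (fun v => u i *+ (v == endpt j e'))); apply: eq_bigr => v _.
  rewrite !sum_bool (eq_sym v); case: i; case: j;
    rewrite ?mulr0n ?mulr1n ?mul0rn ?addr0 ?add0r mulr_mulrb mulr1 mulrb_andr andbC //.
rewrite /rev_weight /=.
have -> : ((e, i) == (e', j)) = (e == e') && (i == j) by [].
have -> : ((if i then ehead e else etail e) == (if j then etail e' else ehead e'))
  = (endpt (~~ i) e == endpt j e') by case: i.
case: (endpt _ e == _); case: (e == e'); case: (i == j);
  rewrite /= ?mulr0n ?mulr1n; ring.
Qed.

End ReversingDeterminant.

(** Here the edges are eliminated from the same gadget matrix. [d] is the determinant of the block
    of an edge and its reverse, and the inverse supplied in the proof is the adjugate divided by
    [d]. *)
Lemma rev_det_geta (K : fieldType) (t u : bool -> K) G :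
  let d := 1 - u true * u false * (t true - 1) * (t false - 1) in
  d != 0 ->
  rev_det t u G = d ^+ #|edge G| *
    geta G 1 (quad (- (u true * u false * (t true - 1)) / d)
                   (- (u true * u false * (t false - 1)) / d)
                   (- u true / d) (- u false / d)).
Proof.
move=> d d0; rewrite rev_det_gadget.
rewrite (@fdet_gadget _ _ _ _ _ _ _ _ (fun i j => (if i == j then 1 else u i * (t i - 1)) / d)).
  congr (_ ^+ _ * _).
    by rewrite fdet_bool /= !mulr0n !mulr1n /d; ring.
  apply: eq_geta => i j; rewrite !sum_bool.
  by case: i; case: j; rewrite /= ?mulr0n ?mulr1n ?sub0r; ring.
move=> i j; rewrite !sum_bool; case: i; case: j;
  rewrite /= ?mulr0n ?mulr1n; apply: (mulIf d0); rewrite /d; field; exact: d0.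
Qed.

Lemma rmorph_rev_det (R S : comNzRingType) (f : {rmorphism R -> S}) (t u : bool -> R) G :
  f (rev_det t u G) = rev_det (fun b => f (t b)) (fun b => f (u b)) G.
Proof.
rewrite rmorph_fdet; apply: eq_fdet => e e'.
by rewrite rmorphB rmorphMn rmorphM rmorphD !rmorphMn rmorphB rmorph1.
Qed.

Lemma eq_rev_det (R : comNzRingType) (t u t' u' : bool -> R) G :
  t =1 t' -> u =1 u' -> rev_det t u G = rev_det t' u' G.
Proof. by move=> et eu; apply: eq_fdet => e e'; rewrite /rev_weight et eu. Qed.

(** Homogeneity, which normalizes the first argument to 1. The power of [x] is where the number of
    vertices enters. *)
Lemma geta_scale (K : fieldType) (x : K) Q H : x != 0 ->
  geta H x Q = x ^+ #|vert H| * geta H 1 (fun d d' => Q d d' / x).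
Proof.
move=> x0; rewrite /geta /fdet -detZ; congr (\det _); apply/matrixP => i j.
rewrite !mxE mulrDr mulrnAr mulr1; congr (_ + _).
rewrite mulr_sumr; apply: eq_bigr => e _; rewrite mulr_sumr; apply: eq_bigr => d _.
rewrite mulr_sumr; apply: eq_bigr => d' _.
by rewrite mulrnAr mulrCA divff // mulr1.
Qed.

Lemma eta_eq_rev_det G G' : eta G = eta G' ->
  forall (R : idomainType) (t u : bool -> R),
  1 - u true * u false * (t true - 1) * (t false - 1) != 0 -> rev_det t u G = rev_det t u G'.
Proof.
move=> e R t u d0; apply/eqP; rewrite -tofrac_eq !rmorph_rev_det; apply/eqP.
have d1 : 1 - tofrac (u true) * tofrac (u false)
    * (tofrac (t true) - 1) * (tofrac (t false) - 1) != 0.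
  by rewrite -[1]/(tofrac (1 : R)) -!tofracB -!tofracM -tofracB tofrac_eq0.
by rewrite !(rev_det_geta _ d1) (eta_card_edge e) (eta_eq_geta e).
Qed.

(* Inverts the change of variables in [rev_det_geta]. *)
Lemma geta_rev_det (K : fieldType) (y z a b : K) : a * b != 0 ->
  let d := 1 - y * z / (a * b) in d != 0 ->
  exists t u : bool -> K, forall G, rev_det t u G = d ^+ #|edge G| * geta G 1 (quad y z a b).
Proof.
rewrite mulf_eq0 negb_or => /andP[a0 b0] d d0.
(* These solve -u/d = a (or b) for u, and then the equations for y and z in [rev_det_geta] for t.
   With them the block determinant is 1 - yz/(ab), as [d] requires. *)
exists (fun i => 1 - (if i then y else z) / (d * a * b)),
  (fun i => - d * (if i then a else b)) => G.
have abd0 : a * b - y * z != 0.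
  have : d * (a * b) != 0 by rewrite !mulf_neq0.
  by rewrite /d mulrBl mul1r divfK // mulf_neq0.
have dE : 1 - (- d * a) * (- d * b) * (1 - y / (d * a * b) - 1) * (1 - z / (d * a * b) - 1) = d.
  by rewrite {5}/d; field; rewrite a0 b0 d0.
rewrite rev_det_geta /= dE //; congr (_ * _); apply: eq_geta => i j.
by case: i; case: j; rewrite /=; field; rewrite ?a0 ?b0 ?d0.
Qed.

(** * Recovering eta from the edge determinant *)

Section RevDetDeterminesEta.
Variables G G' : digraph.
Hypothesis rev_det_eq :
  forall (R : comNzRingType) (t u : bool -> R), rev_det t u G = rev_det t u G'.

(** The arguments y = x(1 - x) and z = a = b = x make [d] equal to x. The edge determinant is then
    x^|E| f(x) with f(0) = 1, so |E| is its order of vanishing at 0. *)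
Lemma rev_det_card_edge : #|edge G| = #|edge G'|.
Proof.
pose x : {fraction {poly int}} := tofrac 'X.
have x0 : x != 0 by rewrite tofrac_eq0 polyX_eq0.
have dxE (K : fieldType) (c : K) : c != 0 -> 1 - (c * (1 - c)) * c / (c * c) = c.
  by move=> c0; field.
have dx := dxE _ _ x0.
have := @geta_rev_det _ (x * (1 - x)) x x x.
rewrite /= dx => /(_ (mulf_neq0 x0 x0) x0) [t [u tuE]].
pose f H : {poly int} := geta H 1 (quad ('X * (1 - 'X)) 'X 'X 'X).
have fE H : geta H 1 (quad (x * (1 - x)) x x x) = tofrac (f H).
  rewrite rmorph_geta rmorph1; apply: eq_geta => d d'.
  by case: d; case: d'; rewrite /= ?tofracM ?tofracB ?tofrac1.
have f0 H : (f H).[0] = 1.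
  rewrite -[LHS]/(horner_eval 0 _) rmorph_geta rmorph1.
  rewrite (@eq_geta _ _ _ _ (fun _ _ => 0)) => [|d d'].
    rewrite /geta /fdet -[RHS](det1 _ #|vert H|) -fmx_scalar; congr (\det _).
    apply: eq_fmx => v w; rewrite /edge_form big1 ?addr0 // => e _.
    by rewrite big1 // => d _; rewrite big1 // => d' _; rewrite mul0rn.
  by case: d; case: d'; rewrite /= /horner_eval !hornerE.
have : 'X^#|edge G| * f G = 'X^#|edge G'| * f G'.
  by apply/eqP; rewrite -tofrac_eq !tofracM !tofracXn -!fE -!tuE rev_det_eq.
have le (H H' : digraph) : 'X^#|edge H| * f H = 'X^#|edge H'| * f H' -> (#|edge H'| <= #|edge H|)%N.
  move=> e; case: leqP => // lt; move: e; rewrite -(subnKC lt) addSnnS exprD -mulrA.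
  move/(mulfI (monic_neq0 (monicXn _ _)))/(congr1 (horner^~ 0)).
  by rewrite hornerM hornerXn expr0n mul0r f0.
by move=> e; apply/eqP; rewrite eqn_leq !le.
Qed.

Lemma rev_det_eta : #|vert G| = #|vert G'| -> eta G = eta G'.
Proof.
move=> nE; rewrite !eta_geta.
set x := 'X_ _; set y := 'X_ _; set z := 'X_ _; set a := 'X_ _; set b := 'X_ _.
apply/eqP; rewrite -tofrac_eq !rmorph_geta; apply/eqP.
have X0 i : tofrac ('X_i : {mpoly int[5]}) != 0.
  rewrite tofrac_eq0 -msupp_eq0 msuppX //.
rewrite !(geta_scale _ _ (X0 _)) nE; congr (_ * _).
rewrite eq_geta_quad [RHS]eq_geta_quad /=.
set X := tofrac x; set Y := tofrac y; set Z := tofrac z; set A := tofrac a; set B := tofrac b.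
have dE (K : fieldType) (p q r s v : K) : p != 0 -> r != 0 -> s != 0 -> r * s - q * v != 0 ->
    1 - (q / p) * (v / p) / ((r / p) * (s / p)) != 0.
  move=> p0 r0 s0 h.
  have -> : 1 - (q / p) * (v / p) / ((r / p) * (s / p)) = (r * s - q * v) / (r * s).
    by field; rewrite p0 r0 s0.
  by rewrite mulf_neq0 ?invr_eq0 ?mulf_neq0.
have ABYZ : A * B - Y * Z != 0.
  rewrite -!tofracM -tofracB tofrac_eq0.
  (* At [z] = 0 with the other variables 1, the difference ab - yz takes the value 1. *)
  apply/eqP => /(congr1 (mmap intr (nth 0 [:: 1; 1; 0; 1; 1] : 'I_5 -> int))).
  by rewrite rmorphB !rmorphM rmorph0 /= !mmapX !mmap1U.
have AB0 : A / X * (B / X) != 0 by rewrite !mulf_neq0 ?invr_eq0 ?X0.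
have d0 := dE _ X Y A B Z (X0 _) (X0 _) (X0 _) ABYZ.
have [t [u tuE]] := geta_rev_det AB0 d0.
by have := rev_det_eq t u; rewrite !tuE rev_det_card_edge => /(mulfI (expf_neq0 _ d0)).
Qed.

End RevDetDeterminesEta.

(** * Logarithmic derivatives of power series *)

Section PowerSeries.
Variable R : comNzRingType.
Implicit Types p q f g s : {poly R}.

Definition cong N p q := forall i, (i <= N)%N -> p`_i = q`_i.

Lemma congM N p p' q q' : cong N p p' -> cong N q q' -> cong N (p * q) (p' * q').
Proof.
move=> hp hq i iN; rewrite !coefM; apply: eq_bigr => j _.
by rewrite hp ?hq // ?(leq_trans _ iN) ?leq_subr // -ltnS.
Qed.

Lemma cong_prod1 N (I : Type) (r : seq I) (P : pred I) (F : I -> {poly R}) :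
  (forall i, P i -> cong N (F i) 1) -> cong N (\prod_(i <- r | P i) F i) 1.
Proof.
move=> h; elim/big_ind: _ => // p q hp hq.
by rewrite -[1]mulr1; apply: congM.
Qed.

(** Inverses modulo z^(N+1) are unique: q = q p' q' = q p q' = q'. *)
Lemma cong_inv N p q p' q' :
  cong N (p * q) 1 -> cong N (p' * q') 1 -> cong N p p' -> cong N q q'.
Proof.
move=> h h' hp.
have h1 : cong N (q * 1) (q * (p' * q')) by apply: congM => // i iN; rewrite h'.
have h2 : cong N (q * (p * q')) (q * (p' * q')) by do 2 apply: congM => //.
have h3 : cong N ((p * q) * q') (1 * q') by apply: congM.
by move=> i iN; rewrite -[q]mulr1 h1 // -h2 // mulrCA mulrA h3 // mul1r.
Qed.

(* [s] is [- z f'(z) / f(z)] up to degree [N]. *)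
Definition logd N f s := cong N (- ('X * f^`())) (f * s).

Lemma coef_Xderiv f i : ('X * f^`())`_i = f`_i *+ i.
Proof. by rewrite coefXM coef_deriv; case: i. Qed.

Lemma logd1 N : logd N 1 0.
Proof. by move=> i _; rewrite derivC mulr0 oppr0 mulr0. Qed.

Lemma logdM N f g s s' : logd N f s -> logd N g s' -> logd N (f * g) (s + s').
Proof.
move=> hf hg i iN.
have -> : - ('X * (f * g)^`()) = - ('X * f^`()) * g + f * - ('X * g^`()) by rewrite derivM; ring.
have -> : f * g * (s + s') = f * s * g + f * (g * s') by ring.
by rewrite !coefD (congM hf (q := g) (q' := g)) // (congM (p := f) (p' := f) _ hg).
Qed.

Lemma logd_prod N (I : Type) (r : seq I) (P : pred I) (f s : I -> {poly R}) :
  (forall i, P i -> logd N (f i) (s i)) ->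
  logd N (\prod_(i <- r | P i) f i) (\sum_(i <- r | P i) s i).
Proof.
move=> h; elim/big_rec2: _ => [|i x y Pi hx]; first exact: logd1.
by apply: logdM => //; apply: h.
Qed.

(** The geometric series for l w z^l / (1 - w z^l), cut after [N] terms; the error starts in degree
    l (N + 1) > N. *)
Lemma logd_factor N (w : R) l : (0 < l)%N ->
  logd N (1 - w *: 'X^l) ((\sum_(k < N) (w *: 'X^l) ^+ k.+1) *+ l).
Proof.
move=> l0; rewrite /logd; set y := w *: 'X^l.
have -> : - ('X * (1 - y)^`()) = y *+ l.
  rewrite derivB derivC sub0r mulrN opprK derivZ derivXn -scalerAr mulrnAr -exprS prednK //.
  by rewrite scalerMnr.
have -> : (1 - y) * ((\sum_(k < N) y ^+ k.+1) *+ l) = y *+ l - y ^+ N.+1 *+ l.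
  under eq_bigr => k _ do rewrite exprS.
  rewrite -mulr_sumr mulrnAr mulrCA -(opprB y 1) mulNr -subrX1 mulrN mulrBr mulr1 -exprS.
  by rewrite opprB mulrnBl.
move=> i iN; rewrite coefB [X in _ - X](_ : _ = 0) ?subr0 //.
rewrite coefMn exprZn -exprM coefZ coefXn ltn_eqF ?mulr0 ?mul0rn //.
by rewrite (leq_trans (n := N.+1)) // leq_pmull.
Qed.

(** Comparing coefficients gives i f_i = - sum of f_j s_(i-j) over j < i. Multiplication by i is
    injective, so f is determined recursively by its constant term. *)
Lemma logd_unique N f g s :
  (forall (x : R) n, x *+ n.+1 = 0 -> x = 0) ->
  f`_0 = 1 -> g`_0 = 1 -> s`_0 = 0 -> logd N f s -> logd N g s -> cong N f g.
Proof.
move=> tf f0 g0 s0 hf hg; elim/ltn_ind => -[|i] IH iN; first by rewrite f0 g0.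
apply/eqP; rewrite -subr_eq0; apply/eqP; apply: (tf _ i).
have coefE h : logd N h s -> h`_i.+1 *+ i.+1 = - \sum_(j < i.+1) h`_j * s`_(i.+1 - j).
  move=> /(_ _ iN); rewrite coefN coef_Xderiv coefM big_ord_recr /= subnn s0 mulr0 addr0.
  by move=> <-; rewrite opprK.
rewrite mulrnBl !coefE // (eq_bigr (fun j : 'I_i.+1 => g`_j * s`_(i.+1 - j))) ?subrr //.
by move=> j _; rewrite IH // ltnW // (leq_trans _ iN).
Qed.


End PowerSeries.

(** * Jacobi's formula and traces of powers *)

Section Jacobi.
Variable R : comNzRingType.

Lemma deriv_prod_ord n (f : 'I_n -> {poly R}) :
  (\prod_i f i)^`() = \sum_k \prod_i (if i == k then (f i)^`() else f i).
Proof.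
elim: n f => [|n IH] f; first by rewrite !big_ord0 derivC.
rewrite big_ord_recl derivM IH big_ord_recl; congr (_ + _).
  by rewrite big_ord_recl eqxx; congr (_ * _); apply: eq_bigr => i _.
rewrite mulr_sumr; apply: eq_bigr => k _; rewrite big_ord_recl.
by congr (_ * _); apply: eq_bigr => i _; rewrite (inj_eq lift_inj).
Qed.

(** Jacobi's formula: by the product rule the rows are differentiated one at a time, and each
    resulting determinant is expanded along its differentiated row. *)
Lemma deriv_det n (M : 'M[{poly R}]_n) :
  (\det M)^`() = \sum_i \sum_j (M i j)^`() * cofactor M i j.
Proof.
pose M' k := \matrix_(i, j) (if i == k then (M i j)^`() else M i j).
have -> : (\det M)^`() = \sum_k \det (M' k).
  rewrite /determinant raddf_sum exchange_big; apply: eq_bigr => s _ /=.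
  have -> : ((-1) ^+ s * \prod_i M i (s i))^`() = (-1) ^+ s * (\prod_i M i (s i))^`().
    by rewrite !mulr_sign; case: (s : bool) => //; rewrite derivN.
  rewrite deriv_prod_ord mulr_sumr; apply: eq_bigr => k _; congr (_ * _).
  by apply: eq_bigr => i _; rewrite mxE.
apply: eq_bigr => k _; rewrite (expand_det_row _ k); apply: eq_bigr => j _.
rewrite mxE eqxx; congr (_ * (_ * \det _)); apply/matrixP => a b.
by rewrite !mxE eq_sym (negPf (neq_lift _ _)).
Qed.

Definition char_det n (W : 'M[R]_n) : {poly R} := \det (1%:M - 'X *: map_mx polyC W).

Lemma logd_det N n (W : 'M[R]_n) :
  logd N (char_det W) (\sum_(k < N) (\tr (W ^+ k.+1))%:P * 'X^(k.+1)).
Proof.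
rewrite /logd /char_det; set Y := 'X *: _; set M := 1%:M - Y; set D := \det M.
have YE k : Y ^+ k = 'X^k *: map_mx polyC (W ^+ k).
  elim: k => [|k IH]; first by rewrite !expr0 scale1r map_mx1.
  rewrite !exprS IH map_mxM /=.
  by rewrite /Y -[_ * _]/(_ *m _) -scalemxAl -scalemxAr scalerA -exprS.
have -> : 'X * D^`() = - \tr (Y *m \adj M).
  rewrite deriv_det /mxtrace -sumrN mulr_sumr; apply: eq_bigr => i _.
  rewrite !mxE mulr_sumr -sumrN; apply: eq_bigr => j _.
  rewrite !mxE derivB derivM derivX derivC mulr0 addr0 mul1r.
  rewrite (_ : (1 *+ (i == j))^`() = 0) ?sub0r; last by case: (i == j); rewrite ?derivC ?raddf0.
  by rewrite mulNr mulrN mulrA.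
(* The truncated Neumann series for the inverse of 1 - Y. The remainder, multiplied by Y, is
   divisible by z^(N+1) and is dropped below. *)
have adjE : \adj M = D *: (\sum_(k < N) Y ^+ k) + \adj M *m Y ^+ N.
  apply/eqP; rewrite -subr_eq; apply/eqP.
  rewrite -[X in X - _](mulmx1 (\adj M)) -mulmxBr.
  have -> : 1%:M - Y ^+ N = M *m \sum_(k < N) Y ^+ k.
    by rewrite -[LHS]opprB -[1%:M]/1 subrX1 -mulNr opprB.
  by rewrite mulmxA mul_adj_mx mul_scalar_mx.
rewrite opprK adjE mulmxDr mxtraceD -scalemxAr mxtraceZ.
move=> i iN; rewrite coefD [X in _ + X](_ : _ = 0) ?addr0; last first.
  rewrite mulmxA mxtrace_mulC mulmxA -[Y ^+ N *m Y]/(Y ^+ N * Y) -exprSr YE -scalemxAl mxtraceZ.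
  by rewrite coefXnM ltnS iN.
have -> // : \tr (Y *m \sum_(k < N) Y ^+ k) = \sum_(k < N) (\tr (W ^+ k.+1))%:P * 'X^(k.+1).
rewrite mulmx_sumr raddf_sum; apply: eq_bigr => k _ /=.
rewrite -[Y *m _]/(Y * _) -exprS YE mxtraceZ mulrC; congr (_ * _).
by rewrite /mxtrace rmorph_sum; apply: eq_bigr => j _; rewrite mxE.
Qed.

End Jacobi.

(** * Cyclic words *)

Section Words.
Local Open Scope nat_scope.
Variables (T : finType) (x0 : T).
Implicit Types s p : seq T.

(** The periodic extension of a word to all natural indices: rotations become shifts, and periods
    can be stated without wrapping around. *)
Definition cyc s i := nth x0 s (i %% size s).

Lemma cycE s i : cyc s i = nth x0 s (i %% size s).
Proof. by []. Qed.

Lemma cyc_small s i : i < size s -> cyc s i = nth x0 s i.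
Proof. by move=> h; rewrite /cyc modn_small. Qed.

Lemma cyc_mod s i : cyc s (i %% size s) = cyc s i.
Proof. by rewrite /cyc modn_mod. Qed.

Lemma cyc_addM s i k : cyc s (i + k * size s) = cyc s i.
Proof. by rewrite /cyc addnC modnMDl. Qed.

Lemma eq_cyc s s' : size s = size s' -> (forall i, cyc s i = cyc s' i) -> s = s'.
Proof.
move=> sz h; apply: (@eq_from_nth _ x0) => // i i_s.
by rewrite -cyc_small // h cyc_small // -sz.
Qed.

Lemma cyc_rot s r i : r <= size s -> cyc (rot r s) i = cyc s (i + r).
Proof.
move=> rs; have [/size0nil -> |s0] := posnP (size s); first by rewrite /cyc !nth_nil.
rewrite /cyc size_rot -(modnDml i); have := ltn_pmod i s0.
move: (i %% size s) => j js; rewrite /rot nth_cat size_drop nth_drop ltn_subRL addnC.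
case: ltnP => jr; first by rewrite modn_small.
have -> : j + r = (j - (size s - r)) + size s by lia.
by rewrite modnDr modn_small ?nth_take //; lia.
Qed.

Definition period s r := forall i, cyc s (i + r) = cyc s i.

Definition periodb s r := all (fun i => cyc s (i + r) == cyc s i) (iota 0 (size s)).

Lemma periodP s r : reflect (period s r) (periodb s r).
Proof.
apply: (iffP allP) => [h i|h i _]; last by rewrite h.
have [/size0nil -> |s0] := posnP (size s); first by rewrite /cyc !nth_nil.
have := h (i %% size s); rewrite mem_iota /= ltn_pmod // => /(_ isT)/eqP.
by rewrite cyc_mod -cyc_mod modnDml cyc_mod.
Qed.

Lemma period_size s : period s (size s).
Proof. by move=> i; rewrite -[X in i + X]mul1n cyc_addM. Qed.

Lemma periodM s r k : period s r -> period s (k * r).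
Proof. by move=> h; elim: k => [|k IH] i; rewrite ?addn0 // mulSnr addnA h IH. Qed.

Lemma period_modn s r r' : period s r -> period s r' -> period s (r' %% r).
Proof.
move=> h h' i; rewrite -[in RHS]h' [in RHS](divn_eq r' r) [_ %/ _ * _ + _]addnC addnA.
by rewrite periodM.
Qed.

(** The candidates start at 1, hence the successor of the position found. For a nonempty word the
    search succeeds, since the length is a period. *)
Definition minper s := (find (periodb s) (iota 1 (size s))).+1.

Lemma minperP s : 0 < size s ->
  [/\ period s (minper s), minper s <= size s &
      forall r, 0 < r -> period s r -> minper s <= r].
Proof.
move=> s0; have hs : has (periodb s) (iota 1 (size s)).
  apply/hasP; exists (size s); last exact/periodP/period_size.
  by rewrite mem_iota s0 add1n ltnS leqnn.
have lt : find (periodb s) (iota 1 (size s)) < size s.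
  by rewrite -[X in _ < X](size_iota 1) -has_find.
split=> //.
  by apply/periodP; have := nth_find 0 hs; rewrite nth_iota // add1n.
move=> [//|r] _ /periodP pr; rewrite ltnS leqNgt; apply/negP => rlt.
by have := before_find 0 rlt; rewrite nth_iota ?(ltn_trans rlt) // add1n pr.
Qed.

(** The remainder of [r] modulo the least period is itself a period, so it must be 0. *)
Lemma minper_dvd s r : 0 < size s -> period s r -> minper s %| r.
Proof.
move=> s0 pr; have [pm _ min] := minperP s0; rewrite /dvdn.
have := min (r %% minper s); case: (posnP (r %% _)) => [->//|r0] h.
by have := h isT (period_modn pm pr); rewrite leqNgt ltn_pmod.
Qed.

Lemma eq_minper s s' : 0 < size s -> 0 < size s' ->
  (forall i, cyc s i = cyc s' i) -> minper s = minper s'.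
Proof.
move=> s0 s0' h; have [p1 _ m1] := minperP s0; have [p2 _ m2] := minperP s0'.
apply/eqP; rewrite eqn_leq m1 // ?m2 // => i; first by rewrite -!h p1.
by rewrite !h p2.
Qed.

(** For [n] a multiple of the length this repeats the word; for [n] a smaller period it cuts out one
    period. Both uses meet in [sum_cycw_minper]. *)
Definition repw n p := mkseq (cyc p) n.

Lemma repw_size n p : size (repw n p) == n.
Proof. by rewrite size_mkseq. Qed.

Canonical repw_tuple n p := Tuple (repw_size n p).

Lemma cyc_repw n p i : 0 < n -> period p n -> cyc (repw n p) i = cyc p i.
Proof.
move=> n0 pn; rewrite /cyc size_mkseq nth_mkseq ?ltn_pmod // -/(cyc p _).
by rewrite [in RHS](divn_eq i n) addnC periodM.
Qed.

Lemma period_dvd p n : size p %| n -> period p n.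
Proof. by case/dvdnP => k ->; apply/periodM/period_size. Qed.

End Words.

Section CyclicWeight.
Variables (R : comNzRingType) (T : finType) (x0 : T) (W : T -> T -> R).
Local Notation cyc := (cyc x0).
Local Notation minper := (minper x0).

Definition cycw (s : seq T) : R := \prod_(i < size s) W (cyc s i) (cyc s i.+1).

Lemma cycw_repw n p : (0 < n)%N -> (size p %| n)%N ->
  cycw (repw x0 n p) = cycw p ^+ (n %/ size p).
Proof.
move=> n0 dvd; have pn := period_dvd x0 dvd.
rewrite /cycw size_mkseq; under eq_bigr => i _ do rewrite !cyc_repw //.
rewrite -!(big_mkord predT (fun i => W (cyc p i) (cyc p i.+1))) /=.
rewrite -{1}(divnK dvd); elim: (n %/ size p)%N => [|k IH]; first by rewrite mul0n big_geq.
rewrite mulSn addnC (big_cat_nat (n := (k * size p)%N)) ?leq_addr //= IH exprSr.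
congr (_ * _); rewrite -{1}[(k * size p)%N]add0n big_addn addnC addnK.
by apply: eq_bigr => i _; rewrite -addSn !cyc_addM.
Qed.

(** A word of length [n] with least period [l] is the (n/l)-th power of its first [l] letters, and
    these again have least period [l]. Sorting by [l] gives the right-hand side. *)
Lemma sum_cycw_minper n N : (0 < n <= N)%N ->
  \sum_(g : n.-tuple T) cycw g =
  \sum_(l < N.+1 | (l %| n)%N) \sum_(p : l.-tuple T | minper p == l) cycw p ^+ (n %/ l).
Proof.
case/andP=> n0 nN.
transitivity (\sum_(g : n.-tuple T) \sum_(l < N.+1) cycw g *+ (minper g == l)).
  apply: eq_bigr => g _.
  have g0 : (0 < size g)%N by rewrite size_tuple.
  have [_ le _] := minperP x0 g0; rewrite size_tuple in le.
  have lt : (minper g < N.+1)%N by rewrite ltnS (leq_trans le).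
  by rewrite -[LHS](sum_delta (fun=> cycw g) (Ordinal lt)).
rewrite exchange_big [RHS]big_mkcond; apply: eq_bigr => -[l /= lN] _.
case: ifP => [ln|ln]; last first.
  apply: big1 => g _; case: eqP => // e; move: ln.
  rewrite -e minper_dvd ?size_tuple //; have := @period_size _ x0 g; by rewrite size_tuple.
have l0 : (0 < l)%N by apply: dvdn_gt0 ln.
transitivity (\sum_(g : n.-tuple T | minper g == l) cycw g).
  by rewrite [RHS]big_mkcond; apply: eq_bigr => g _; case: (_ == _).
have repK (p : l.-tuple T) : repw x0 l (repw x0 n p) = p.
  apply: (@eq_cyc _ x0) => [|i]; first by rewrite size_mkseq size_tuple.
  have pl : period x0 p l by have := @period_size _ x0 p; rewrite size_tuple.
  have pn : period x0 p n by apply: period_dvd; rewrite size_tuple.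
  have h j : cyc (repw x0 n p) j = cyc p j by apply: cyc_repw.
  by rewrite cyc_repw // => j; rewrite !h.
rewrite (reindex_onto (fun p : l.-tuple T => [tuple of repw x0 n p])
                      (fun g : n.-tuple T => [tuple of repw x0 l g])) /=; last first.
  move=> g /eqP gl; apply: val_inj => /=.
  have g0 : (0 < size g)%N by rewrite size_tuple.
  have [pg _ _] := minperP x0 g0; rewrite gl in pg.
  apply: (@eq_cyc _ x0) => [|i]; first by rewrite size_mkseq size_tuple.
  rewrite cyc_repw; first by rewrite cyc_repw.
    by [].
  move=> j; rewrite !cyc_repw //; have := @period_size _ x0 g; rewrite size_tuple; exact.
apply: eq_big => [p|p _]; last by rewrite cycw_repw ?size_tuple.
have pn : period x0 p n by apply: period_dvd; rewrite size_tuple.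
have -> : minper (repw x0 n p) = minper p.
  by apply: eq_minper => [||i]; rewrite ?size_mkseq ?size_tuple // cyc_repw.
by rewrite andb_idr // => _; apply/eqP/val_inj/repK.
Qed.

Fixpoint pathw (x : T) (s : seq T) : R := if s is y :: s' then W x y * pathw y s' else 1.

Lemma pathwE x s : pathw x s = \prod_(i < size s) W (nth x0 (x :: s) i) (nth x0 s i).
Proof. by elim: s x => [|y s IH] x /=; rewrite ?big_ord0 // big_ord_recl IH. Qed.

Lemma cycw_cons x s : cycw (x :: s) = pathw x (rcons s x).
Proof.
rewrite pathwE /cycw size_rcons; apply: eq_bigr => -[i /= si] _.
rewrite cyc_small // -rcons_cons nth_rcons /= si; congr (W _ _).
rewrite cycE nth_rcons; move: si; rewrite ltnS leq_eqVlt => /orP[/eqP ->|si].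
  by rewrite modnn ltnn eqxx.
by rewrite /= modn_small ?ltnS // si.
Qed.

Lemma sum_tuple_cons n (F : seq T -> R) :
  \sum_(g : n.+1.-tuple T) F g = \sum_x \sum_(s : n.-tuple T) F (x :: s).
Proof.
rewrite -(sum_pair (fun p : T * n.-tuple T => F (p.1 :: p.2))).
rewrite (reindex (fun p : T * n.-tuple T => [tuple of p.1 :: p.2])) //=.
exists (fun g : n.+1.-tuple T => (thead g, [tuple of behead g])) => [[x s] _|g _] /=.
  by rewrite theadE; congr (_, _); apply: val_inj.
by rewrite -tuple_eta.
Qed.

Lemma expr_fmx n i j : (fmx W ^+ n.+1) i j =
  \sum_(s : n.-tuple T) pathw (enum_val i) (rcons s (enum_val j)).
Proof.
elim: n i => [|n IH] i.
  rewrite expr1 mxE (big_pred1 [tuple]) /= ?mulr1 // => s.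
  exact/esym/eqP/tuple0.
rewrite exprS mxE (sum_tuple_cons n (fun s => pathw (enum_val i) (rcons s (enum_val j)))).
rewrite -[RHS]sum_enum_val; apply: eq_bigr => k _.
by rewrite IH mxE mulr_sumr.
Qed.

(** A diagonal entry sums over the closed walks from one letter, which becomes the first letter of
    the cyclic word. *)
Lemma mxtrace_expr_fmx n : \tr (fmx W ^+ n.+1) = \sum_(g : n.+1.-tuple T) cycw g.
Proof.
rewrite (sum_tuple_cons n cycw) -[RHS]sum_enum_val; apply: eq_bigr => i _.
by rewrite expr_fmx; apply: eq_bigr => s _; rewrite cycw_cons.
Qed.

End CyclicWeight.

(** * Primitive circuits *)

Lemma primitive_cycles_partition H l : (0 < l)%N ->
  partition (primitive_cycles H l) (primitive_circuits H l).
Proof.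
move=> l0; apply: equivalence_partitionP => x y z _ _ _.
exact: rotation_equiv.
Qed.

Lemma primitive_repsP H l : (0 < l)%N ->
  is_transversal (primitive_reps H l) (primitive_cycles H l) (primitive_circuits H l).
Proof. by move=> l0; apply: transversalP (primitive_cycles_partition H l0). Qed.

Lemma primitive_reps_circuit H l (g : l.-tuple (edge H)) : (0 < l)%N ->
  g \in primitive_reps H l -> circuit g.
Proof.
move=> l0 /(subsetP (transversal_sub (primitive_repsP H l0))).
by rewrite inE => /andP[].
Qed.

Section PrimitiveCircuits.
Variables (H : digraph) (x0 : edge H).
Local Notation cyc := (cyc x0).
Local Notation period := (period x0).
Local Notation minper := (minper x0).

Lemma tnth_cyc l (g : l.-tuple (edge H)) i : tnth g i = cyc g i.
Proof. by rewrite (tnth_nth x0) cyc_small // size_tuple. Qed.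

Lemma tnth_ordS_cyc l (g : l.-tuple (edge H)) i : tnth g (ordS i) = cyc g i.+1.
Proof. by rewrite (tnth_nth x0) /cyc size_tuple. Qed.

Lemma circuitP l (g : l.-tuple (edge H)) :
  reflect ((0 < l)%N /\ forall i, ehead (cyc g i) = etail (cyc g i.+1)) (circuit g).
Proof.
apply: (iffP andP) => -[l0 h]; split=> //.
  move=> i; have := forallP h (Ordinal (ltn_pmod i l0)).
  rewrite tnth_cyc tnth_ordS_cyc /= => /eqP.
  have := cyc_mod x0 g i; rewrite size_tuple => ->.
  have <- := cyc_mod x0 g (i %% l).+1; rewrite size_tuple -addn1 modnDml addn1.
  by have := cyc_mod x0 g i.+1; rewrite size_tuple => ->.
by apply/forallP => i; rewrite tnth_cyc tnth_ordS_cyc h.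
Qed.

Lemma rotationP l (g g' : l.-tuple (edge H)) :
  reflect (exists2 r, (r < l)%N & forall i, cyc g' i = cyc g (i + r)) (rotation g g').
Proof.
apply: (iffP existsP) => [[r /eqP e]|[r rl h]].
  by exists r => // i; rewrite e cyc_rot // size_tuple ltnW.
exists (Ordinal rl); apply/eqP; apply: (@eq_cyc _ x0) => [|i].
  by rewrite size_rot !size_tuple.
by rewrite h cyc_rot // size_tuple ltnW.
Qed.

Lemma nth_flatten_nseq (k : nat) (d : seq (edge H)) i : (i < k * size d)%N ->
  nth x0 (flatten (nseq k d)) i = cyc d i.
Proof.
elim: k i => [|k IH] i //=; rewrite mulSn nth_cat => ik.
case: ltnP => h; first by rewrite cyc_small.
by rewrite IH ?ltn_subLR // -[in RHS](subnK h) -[X in (_ + X)%N]mul1n cyc_addM.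
Qed.

Lemma size_flatten_nseq (k : nat) (d : seq (edge H)) : size (flatten (nseq k d)) = (k * size d)%N.
Proof. by elim: k => //= k IH; rewrite size_cat IH mulSn. Qed.

(** A least period below [l] divides [l] and exhibits [g] itself as a repetition. Conversely, if a
    rotation of [g] repeats a word of length m < l, then m is a period of that rotation, hence of
    [g]. *)
Lemma primitive_circuitE l (g : l.-tuple (edge H)) :
  primitive_circuit g = circuit g && (minper g == l).
Proof.
rewrite /primitive_circuit; case cg: (circuit g) => //=.
have [l0 cgP] := circuitP _ cg.
have g0 : (0 < size g)%N by rewrite size_tuple.
have [pm ml min] := minperP x0 g0; rewrite size_tuple in ml.
have pl : period g l by have := @period_size _ x0 g; rewrite size_tuple.
apply/forallP/eqP => [h|mE g'].
  apply/eqP; rewrite eqn_leq ml leqNgt; apply/negP => lt.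
  have m0 : (0 < minper g)%N by [].
  have dvd : (minper g %| l)%N by apply: minper_dvd.
  have /implyP := h g; case/(_ _)/negP.
    by apply/rotationP; exists 0%N => // i; rewrite addn0.
  have kl : (l %/ minper g < l.+1)%N by rewrite ltnS leq_div.
  apply/existsP; exists (Ordinal kl).
  apply/existsP; exists (Ordinal (leqW lt : (minper g < l.+1)%N)).
  have szd : size (repw x0 (minper g) g) == minper g by rewrite size_mkseq.
  apply/existsP; exists (Tuple szd) => /=.
  have cE i : cyc (repw x0 (minper g) g) i = cyc g i by apply: cyc_repw.
  apply/and3P; split.
  - by rewrite ltn_divRL // mul1n.
  - by apply/circuitP; split=> // i; rewrite !cE.
  - apply/eqP/(@eq_from_nth _ x0).
      by rewrite size_flatten_nseq (eqP szd) divnK // size_tuple.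
    move=> i ig; rewrite nth_flatten_nseq ?cE ?cyc_small //.
    by rewrite (eqP szd) divnK // -(size_tuple g).
apply/implyP => /rotationP [r rl rE]; apply/negP.
case/existsP => -[k /= _] /existsP[[m /= _]] /existsP[d] /and3P[k1 /circuitP[m0 _] /eqP g'E].
have lE : l = (k * m)%N by rewrite -(size_tuple g') g'E size_flatten_nseq size_tuple.
suff pg : period g m.
  by have := min m m0 pg; rewrite mE lE leqNgt -{1}[m]mul1n ltn_pmul2r // k1.
have pg' i : cyc g' (i + m) = cyc g' i.
  have cE j : cyc g' j = cyc d j.
    rewrite -cyc_mod size_tuple cyc_small ?size_tuple ?ltn_pmod // g'E.
    rewrite nth_flatten_nseq ?size_tuple -?lE ?ltn_pmod //.
    rewrite [in RHS](divn_eq j l) addnC {4}lE mulnA.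
    by have := cyc_addM x0 d (j %% l) (j %/ l * k); rewrite size_tuple.
  by rewrite !cE; have := @period_size _ x0 d; rewrite size_tuple.
move=> i.
(* Going back by [r] is replaced by going forward by [l - r], which stays within the natural
   numbers. *)
have sh j : cyc g j = cyc g' (j + (l - r)).
  by rewrite rE -addnA subnK 1?ltnW // pl.
by rewrite !sh addnAC pg'.
Qed.

Lemma primitive_circuit_rotation l (g g' : l.-tuple (edge H)) :
  rotation g g' -> primitive_circuit g -> primitive_circuit g'.
Proof.
move=> /rotationP[r rl rE]; rewrite !primitive_circuitE => /andP[/circuitP[l0 cg] /eqP mE].
have g0 : (0 < size g)%N by rewrite size_tuple.
have g'0 : (0 < size g')%N by rewrite size_tuple.
apply/andP; split.
  by apply/circuitP; split=> // i; rewrite !rE cg addSn.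
have [pm' ml' _] := minperP x0 g'0; have [_ _ min] := minperP x0 g0.
rewrite size_tuple in ml'; rewrite eqn_leq ml' -{1}mE min // => i.
have pl : period g l by have := @period_size _ x0 g; rewrite size_tuple.
have sh j : cyc g j = cyc g' (j + (l - r)).
  by rewrite rE -addnA subnK 1?ltnW // pl.
by rewrite !sh addnAC pm'.
Qed.

(** Two coinciding rotations by r < r' would give the period r' - r, smaller than the least period
    [l]. *)
Lemma card_rotations l (g : l.-tuple (edge H)) : primitive_circuit g ->
  #|[set g' | rotation g g']| = l.
Proof.
rewrite primitive_circuitE => /andP[/circuitP[l0 _] /eqP mE].
have g0 : (0 < size g)%N by rewrite size_tuple.
have [_ _ min] := minperP x0 g0.
have le (r r' : 'I_l) : rot r g = rot r' g -> (r <= r')%N -> r = r'.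
  move=> e rr'; apply: val_inj; apply/eqP; rewrite eqn_leq rr' /= leqNgt; apply/negP => lt.
  have d0 : (0 < r' - r)%N by rewrite subn_gt0.
  suff /(min _ d0) : period g (r' - r).
    by rewrite mE leqNgt (leq_ltn_trans (leq_subr _ _)).
  have rl : (r <= l)%N by rewrite ltnW.
  have r'l : (r' <= l)%N by rewrite ltnW.
  have pl : period g l by have := @period_size _ x0 g; rewrite size_tuple.
  move=> i; rewrite -pl -[in RHS]pl.
  have <- : (i + (l - r) + r' = i + (r' - r) + l)%N by lia.
  have -> : (i + l = i + (l - r) + r)%N by lia.
  have rotE (q : 'I_l) j : cyc g (j + q) = cyc (rot q g) j.
    by rewrite cyc_rot // size_tuple ltnW.
  by rewrite !rotE e.
have inj : injective (fun r : 'I_l => [tuple of rot r g]).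
  move=> r r' /(congr1 val) /= e; case/orP: (leq_total r r') => h; first exact: le.
  by apply: esym; apply: le.
rewrite -[RHS](card_ord l) -(card_imset _ inj); apply: eq_card => g'; rewrite !inE.
apply/existsP/imsetP => [[r /eqP e]|[r _ ->]]; last by exists r.
by exists r => //; apply: val_inj.
Qed.

(** Rotations of primitive circuits are primitive, so each class is a full rotation orbit and has
    [l] elements. *)
Lemma sum_primitive_reps (R : nmodType) l (F : l.-tuple (edge H) -> R) : (0 < l)%N ->
  (forall g g', rotation g g' -> F g = F g') ->
  \sum_(g in primitive_circuits H l) F g = \sum_(g in primitive_reps H l) F g *+ l.
Proof.
move=> l0 Frot.
have rotE := rotation_equiv l0.
have part := primitive_cycles_partition H l0; have trX := primitive_repsP H l0.
have eqv : {in primitive_circuits H l & &, equivalence_rel (@rotation H l)}.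
  by move=> x y z _ _ _; apply: rotE.
rewrite (set_partition_big _ part) /=.
rewrite -(pblock_transversal trX) big_imset /=; last exact: (pblock_inj trX).
apply: eq_bigr => g gX; have gP : g \in primitive_circuits H l.
  by apply: (subsetP (transversal_sub trX)).
have blockE : pblock (primitive_cycles H l) g = [set g' | rotation g g'].
  apply/setP => g'; rewrite inE; case g'P: (g' \in primitive_circuits H l).
    by rewrite pblock_equivalence_partition.
  apply/idP/idP => [h|h].
    suff : g' \in primitive_circuits H l by rewrite g'P.
    rewrite -(cover_partition part); apply/bigcupP.
    by exists (pblock (primitive_cycles H l) g) => //; apply: pblock_mem;
      rewrite (cover_partition part).
  by move: gP g'P; rewrite !inE => /(primitive_circuit_rotation h) ->.
rewrite (eq_bigr (fun=> F g)) => [|g']; last by rewrite blockE inE => /Frot.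
by rewrite sumr_const blockE card_rotations //; move: gP; rewrite inE.
Qed.

End PrimitiveCircuits.

(** * The Euler product *)

Section EulerProduct.
Variables (R : comNzRingType) (H : digraph) (W : edge H -> edge H -> R).
Hypothesis torsion_free : forall (x : R) n, x *+ n.+1 = 0 -> x = 0.
Hypothesis W_adj : forall e e', ehead e != etail e' -> W e e' = 0.

Definition circw l (g : l.-tuple (edge H)) : R :=
  \prod_i W (tnth g i) (tnth g (ordS i)).

Lemma circw_cycw x0 l (g : l.-tuple (edge H)) : circw g = cycw x0 W g.
Proof.
rewrite /cycw /circw size_tuple; apply: eq_bigr => i _.
by rewrite (tnth_cyc x0) (tnth_ordS_cyc x0).
Qed.

Lemma circw_rotation l (g g' : l.-tuple (edge H)) : rotation g g' -> circw g = circw g'.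
Proof.
case/rotation_tnth => f [injf fS gE].
rewrite /circw (reindex_inj injf); apply: eq_bigr => i _.
by rewrite !gE fS.
Qed.

Lemma circw_circuit l (g : l.-tuple (edge H)) : (0 < l)%N -> ~~ circuit g -> circw g = 0.
Proof.
move=> l0; rewrite /circuit l0 => /forallPn[i hi].
by rewrite /circw (bigD1 i) //= W_adj // mul0r.
Qed.

Lemma coef_sum_expr (w : R) l n N : (0 < l)%N -> (0 < n <= N)%N ->
  (\sum_(k < N) (w *: 'X^l) ^+ k.+1)`_n = if (l %| n)%N then w ^+ (n %/ l) else 0.
Proof.
move=> l0 /andP[n0 nN]; rewrite coef_sum.
have cE k : ((w *: 'X^l) ^+ k.+1)`_n = w ^+ k.+1 *+ (n == l * k.+1)%N.
  by rewrite exprZn -exprM coefZ coefXn mulr_natr.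
case: ifP => [/dvdnP[q nE]|ln]; last first.
  by apply: big1 => k _; rewrite cE; case: eqP => // e; rewrite e dvdn_mulr in ln.
have q0 : (0 < q)%N by move: n0; rewrite nE; case: q {nE}.
have qN : (q.-1 < N)%N by rewrite prednK // (leq_trans _ nN) // nE leq_pmulr.
rewrite [in RHS]nE mulnK // -[q in RHS]prednK //.
rewrite -[RHS](sum_delta (fun k : 'I_N => w ^+ k.+1) (Ordinal qN)).
apply: eq_bigr => k _; rewrite cE nE mulnC eqn_pmul2l // -val_eqE /=.
by rewrite -(prednK q0) eqSS.
Qed.

(** By [logd_unique] it suffices to compare logarithmic derivatives. In degree n the product gives
    the sum over l dividing n of circw^(n/l) over all primitive circuits of length l, and
    [sum_cycw_minper] identifies this with tr(W^n). *)
Lemma euler_product N :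
  cong N (\prod_(1 <= l < N.+1) \prod_(g in primitive_reps H l) (1 - circw g *: 'X^l))
         (char_det (fmx W)).
Proof.
(* Cyclic words need a default letter [x0]. Without edges, both sides are 1. *)
case: (pickP (fun _ : edge H => true)) => [x0 _|no_edge]; last first.
  have -> : char_det (fmx W) = 1.
    rewrite /char_det; move: (1%:M - _).
    by rewrite (eq_card0 no_edge) => M; apply: det_mx00.
  rewrite big_nat; apply: cong_prod1 => l /andP[l0 _]; apply: cong_prod1 => g _.
  by have := no_edge (tnth g (Ordinal l0)).
pose s := \sum_(1 <= l < N.+1) \sum_(g in primitive_reps H l)
  (\sum_(k < N) (circw g *: 'X^l) ^+ k.+1) *+ l.
have ls : logd N (\prod_(1 <= l < N.+1) \prod_(g in primitive_reps H l) (1 - circw g *: 'X^l)) s.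
  rewrite /s big_nat [X in logd _ _ X]big_nat; apply: logd_prod => l /andP[l0 _].
  by apply: logd_prod => g _; apply: logd_factor.
have ld := @logd_det _ N _ (fmx W); set s' := (X in logd _ _ X) in ld.
have s0 : s'`_0 = 0.
  by rewrite coef_sum big1 // => k _; rewrite coefCM coefXn mulr0.
have ss' : cong N s s'.
  move=> [|n] nN.
    rewrite s0 coef_sum big_nat big1 // => l /andP[l0 _].
    rewrite coef_sum big1 // => g _; rewrite coefMn coef_sum big1 ?mul0rn // => k _.
    by rewrite exprZn -exprM coefZ coefXn -[0%N]/(0%N) ltn_eqF ?mulr0 // muln_gt0 l0.
  have -> : s'`_n.+1 = \tr (fmx W ^+ n.+1).
    rewrite coef_sum -[RHS](sum_delta (fun k : 'I_N => \tr (fmx W ^+ k.+1)) (Ordinal nN)).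
    by apply: eq_bigr => k _; rewrite coefCM coefXn eqSS mulr_natr -val_eqE.
  rewrite (mxtrace_expr_fmx x0) (@sum_cycw_minper _ _ x0 W n.+1 N) //.
  rewrite coef_sum -(big_mkord (fun l => (l %| n.+1)%N) (fun l =>
    \sum_(p : l.-tuple (edge H) | minper x0 p == l) cycw x0 W p ^+ (n.+1 %/ l))).
  (* The term l = 0 drops out, since 0 does not divide n + 1. *)
  rewrite [RHS]big_ltn_cond //= [RHS]big_mkcond /=.
  rewrite big_nat [RHS]big_nat; apply: eq_bigr => l /andP[l0 _].
  rewrite coef_sum (eq_bigr (fun g : l.-tuple (edge H) =>
    (if (l %| n.+1)%N then circw g ^+ (n.+1 %/ l) else 0) *+ l)) => [|g _]; last first.
    by rewrite coefMn coef_sum_expr.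
  case: ifP => ln; last by apply: big1 => g _; rewrite mul0rn.
  rewrite -(sum_primitive_reps x0 (F := fun g => circw g ^+ (n.+1 %/ l))) // =>
    [|g g' /circw_rotation -> //].
  (* The trace runs over all words, but a word that is not a circuit has weight 0, and the exponent
     is positive. *)
  rewrite big_mkcond [RHS]big_mkcond; apply: eq_bigr => g _.
  rewrite inE (primitive_circuitE x0) (circw_cycw x0); case cg: (circuit g) => //=.
  case: ifP => // _; rewrite -(circw_cycw x0) circw_circuit ?cg // expr0n.
  by rewrite -leqn0 leqNgt divn_gt0 // dvdn_leq.
apply: (logd_unique torsion_free _ _ s0 _ ld).
- have h (p q : {poly R}) : p`_0 = 1 -> q`_0 = 1 -> (p * q)`_0 = 1.
    by move=> p0 q0; rewrite coef0M p0 q0 mulr1.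
  rewrite big_nat; apply: (big_ind (fun p : {poly R} => p`_0 = 1)) => [||l /andP[l0 _]];
    rewrite ?coef1 //.
  apply: (big_ind (fun p : {poly R} => p`_0 = 1)) => [||g _]; rewrite ?coef1 //.
  by rewrite coefB coef1 coefZ coefXn (ltn_eqF l0) mulr0 subr0.
- rewrite /char_det -horner_coef0 -[LHS]/(horner_eval 0 _) -det_map_mx -[RHS](det1 _ #|edge H|).
  congr (\det _); apply/matrixP => i j; rewrite !mxE /= /horner_eval !hornerE.
  by rewrite subr0 -polyC_natr hornerC.
- by move=> i iN; rewrite ls //; apply: congM ss' i iN.
Qed.

End EulerProduct.

(** * The reversing zeta function *)

Lemma torsion_free_char0 (R : idomainType) : (forall n, n.+1%:R != 0 :> R) ->
  forall (x : R) n, x *+ n.+1 = 0 -> x = 0.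
Proof.
move=> char0 x n /eqP; rewrite -mulr_natr mulf_eq0 (negPf (char0 n)) orbF.
by move/eqP.
Qed.

Lemma prod_if_card (R : comNzRingType) (I : finType) (P : pred I) (x : R) :
  \prod_i (if P i then x else 1) = x ^+ #|[set i | P i]|.
Proof.
rewrite -big_mkcond prodr_const; congr (_ ^+ _); apply: eq_card => i.
by rewrite inE.
Qed.

(** Step by step along the circuit. When the direction changes, a backtrack joins two edges of G
    with the same ends; these coincide in a simple digraph, so [rev_weight] puts t exactly where
    [nback] counts. *)
Lemma circw_rev_weight (R : comNzRingType) (t u : bool -> R) G l
    (g : l.-tuple (edge (reversing_double G))) : simple_digraph G -> circuit g ->
  circw (@rev_weight _ t u G) g =
    t true ^+ nback true false g * t false ^+ nback false true g
    * (u true ^+ ndir true g * u false ^+ ndir false g).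
Proof.
move=> [_ simple] /andP[l0 /forallP cg].
rewrite /circw /ndir /nback -!prod_if_card -!big_split.
apply: eq_bigr => i _ /=; rewrite /rev_weight (eqP (cg i)) eqxx mulr1n.
move: (cg i); set e := tnth g i; set e' := tnth g (ordS i) => /eqP ce.
have backE : e.2 != e'.2 -> backtracks e e' = (e.1 == e'.1).
  move: e e' ce => [e d] [e' d']; rewrite /backtracks /dir /=.
  case: d; case: d' => //= ce _; apply/andP/eqP => [[/eqP h1 /eqP h2]|->]; rewrite ?eqxx //;
    by apply: simple.
rewrite /dir; move: backE; case: (e.2); case: (e'.2) => /= backE;
  rewrite ?andbF /= ?backE //; try case: (_ == _); rewrite /= ?mulr0n ?mulr1n; ring.
Qed.

(** * Grading by total degree *)

Section Grading.
Variables (R : comNzRingType) (n : nat) (A : comNzRingType) (f : {rmorphism {mpoly R[n]} -> A}).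

Definition grade_var (i : 'I_n) : {poly A} := 'X * (f 'X_i)%:P.

(* ['X_i |-> z f('X_i)] turns the total degree into the degree in z. *)
Definition grade : {rmorphism {mpoly R[n]} -> {poly A}} :=
  mmap (polyC \o f \o @mpolyC n R) grade_var.

Lemma gradeC c : grade c%:MP = (f c%:MP)%:P.
Proof. exact: mmapC. Qed.

Lemma gradeXU i : grade 'X_i = 'X * (f 'X_i)%:P.
Proof. by rewrite /= mmapX mmap1U. Qed.

Lemma gradeX m : grade 'X_[m] = 'X^(mdeg m) * (f 'X_[m])%:P.
Proof.
rewrite mpolyXE_id !rmorph_prod mdegE -prodrXr -big_split /=.
by apply: eq_bigr => i _; rewrite !rmorphXn -exprMn /= -gradeXU.
Qed.

Definition homog_part d (p : {mpoly R[n]}) : {mpoly R[n]} :=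
  \sum_(m <- msupp p | mdeg m == d) p@_m *: 'X_[m].

Lemma mcoeff_homog_part d p m : (homog_part d p)@_m = p@_m *+ (mdeg m == d).
Proof.
rewrite [p in RHS]mpolyE !raddf_sum -sumrMnl big_mkcond; apply: eq_bigr => k _ /=.
rewrite mcoeffZ mcoeffX; case: (k =P m) => [<-|_].
  by case: ifP => _; rewrite ?mcoeffZ ?mcoeffX ?eqxx.
by rewrite mulr0 mul0rn; case: ifP => _;
  rewrite ?mcoeff0 // mcoeffZ mcoeffX; case: eqP; rewrite ?mulr0.
Qed.

(** This lets truncation by total degree in the u variables be read as truncation in the single
    variable z. *)
Lemma coef_grade p d : (grade p)`_d = f (homog_part d p).
Proof.
rewrite {1}[p]mpolyE !rmorph_sum coef_sum [RHS]big_mkcond; apply: eq_bigr => k _.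
rewrite -mul_mpolyC !rmorphM gradeC gradeX mulrCA coefXnM -polyCM.
rewrite coefC subn_eq0 ltnNge; case: ltngtP => //=.
Qed.

Lemma cong_grade N p q :
  (forall m, (mdeg m <= N)%N -> p@_m = q@_m) -> cong N (grade p) (grade q).
Proof.
move=> h i iN; rewrite !coef_grade; congr (f _); apply/mpolyP => m.
by rewrite !mcoeff_homog_part; case: eqP => // mi; rewrite h // mi.
Qed.

Lemma cong_grade_inj N p q : injective f -> cong N (grade p) (grade q) ->
  forall m, (mdeg m <= N)%N -> p@_m = q@_m.
Proof.
move=> injf h m mN; have := h _ mN; rewrite !coef_grade => /injf/(congr1 (mcoeff m)).
by rewrite !mcoeff_homog_part eqxx.
Qed.

End Grading.

Definition zt (A : comNzRingType) (f : {mpoly {mpoly int[2]}[2]} -> A) (b : bool) : A :=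
  f ('X_(if b then v_up else v_dn))%:MP.
Definition zu (A : comNzRingType) (f : {mpoly {mpoly int[2]}[2]} -> A) (b : bool) : A :=
  f 'X_(if b then v_up else v_dn).

Lemma weight_circw (A : comNzRingType) (f : {rmorphism {mpoly {mpoly int[2]}[2]} -> A})
    G l (g : l.-tuple (edge (reversing_double G))) : simple_digraph G -> circuit g ->
  f (weight g) = circw (@rev_weight _ (zt f) (zu f) G) g.
Proof.
move=> simple cg; rewrite circw_rev_weight // /weight -mul_mpolyC.
by rewrite !rmorphM !rmorphXn.
Qed.

Lemma rev_weight_graded (A : comNzRingType) (t u : bool -> A) G e e' :
  @rev_weight _ (fun b => (t b)%:P) (fun b => 'X * (u b)%:P) G e e' =
    'X * (rev_weight t u e e')%:P.
Proof. by rewrite /rev_weight rmorphM rmorphD !rmorphMn rmorphB rmorph1 mulrA. Qed.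

Section Zeta.
Variables (A : idomainType) (f : {rmorphism {mpoly {mpoly int[2]}[2]} -> A}).
Hypothesis char0 : forall n, n.+1%:R != 0 :> A.

Local Notation W G := (@rev_weight A (zt f) (zu f) G).

Lemma grade_weight G l (g : l.-tuple (edge (reversing_double G))) :
  simple_digraph G -> circuit g -> grade f (weight g) = circw (W G) g *: 'X^l.
Proof.
move=> simple cg; rewrite weight_circw //.
rewrite /circw (eq_bigr (fun i => 'X * (W G (tnth g i) (tnth g (ordS i)))%:P)).
  by rewrite big_split /= prodr_const card_ord -mul_polyC mulrC rmorph_prod.
move=> i _; rewrite -rev_weight_graded.
by rewrite /rev_weight /zt /zu gradeC gradeXU.
Qed.

Definition zdet G : {poly A} := char_det (fmx (W G)).

Lemma zdet_rev_det G :
  zdet G = rev_det (fun b => (zt f b)%:P) (fun b => 'X * (zu f b)%:P) G.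
Proof.
rewrite /zdet /char_det /rev_det /fdet; congr (\det _); apply/matrixP => i j.
rewrite !mxE (inj_eq enum_val_inj); congr (_ - _).
by rewrite rev_weight_graded.
Qed.

(** After [zdet] is replaced by its Euler product, the factors pair off: (1 + y + ... + y^N)(1 - y)
    = 1 - y^(N+1), where y is divisible by z. *)
Lemma zeta_euler G N : simple_digraph G -> cong N (grade f (zeta_part G N) * zdet G) 1.
Proof.
move=> simple.
(* The backtracking term is present only when [e'] is the reverse of [e], which starts where [e]
   ends. *)
have W_adj e e' : ehead e != etail e' -> W G e e' = 0.
  move=> ne; rewrite /rev_weight (negPf ne) add0r.
  case: eqP => [e1|_]; last by rewrite mulr0n mulr0.
  case: (e.2 =P e'.2) => [_|e2]; first by rewrite mulr0n mulr0.
  by case/negP: ne; move: e e' e1 e2 => [e [] ] [e' [] ] /= -> //.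
have euler := @euler_product _ _ _ (torsion_free_char0 char0) W_adj N.
set P := (X in cong N X _) in euler.
have EP : cong N (grade f (zeta_part G N) * P) (grade f (zeta_part G N) * zdet G).
  by apply: congM.
suff h : cong N (grade f (zeta_part G N) * P) 1 by move=> i iN; rewrite -EP // h.
rewrite /zeta_part /P !big_nat rmorph_prod -big_split /=; apply: cong_prod1 => l /andP[l0 _].
rewrite rmorph_prod -big_split /=; apply: cong_prod1 => g gX.
have cg := @primitive_reps_circuit (reversing_double G) l g l0 gX.
rewrite rmorph_sum /=.
under eq_bigr => k _ do rewrite rmorphXn /= (@grade_weight G l g simple cg).
set y := _ *: 'X^l; rewrite big_mkord mulrC -opprB mulNr -subrX1 opprB.
move=> i iN; rewrite coefB [X in _ - X](_ : _ = 0) ?subr0 //.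
rewrite exprZn -exprM coefZ coefXn ltn_eqF ?mulr0 //.
by rewrite (leq_trans (n := N.+1)) // leq_pmull.
Qed.

Lemma zeta_zdet G G' : simple_digraph G -> simple_digraph G' ->
  zeta G =1 zeta G' -> zdet G = zdet G'.
Proof.
move=> simple simple' h; apply/polyP => i.
have hz : cong i (grade f (zeta_part G i)) (grade f (zeta_part G' i)).
  by apply: cong_grade => m mi; rewrite !zeta_stable.
exact: (cong_inv (@zeta_euler G i simple) (@zeta_euler G' i simple') hz).
Qed.

Lemma zdet_zeta G G' : injective f -> simple_digraph G -> simple_digraph G' ->
  zdet G = zdet G' -> zeta G =1 zeta G'.
Proof.
move=> injf simple simple' h m.
rewrite -!(zeta_stable _ (leqnn (mdeg m))).
apply: (cong_grade_inj injf _ (leqnn (mdeg m))).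
have e := @zeta_euler G (mdeg m) simple; have e' := @zeta_euler G' (mdeg m) simple'.
rewrite mulrC in e; rewrite mulrC in e'; apply: (cong_inv e e').
by rewrite h.
Qed.

Lemma eta_zdet G G' : eta G = eta G' -> zdet G = zdet G'.
Proof.
move=> e; rewrite !zdet_rev_det; apply: eta_eq_rev_det => //.
(* The block determinant is nonzero because u carries a factor z, so its value at z = 0 is 1. *)
apply/eqP => /(congr1 (fun p : {poly A} => p.[0])).
by move=> /eqP; rewrite !hornerE ?mul0r ?subr0 ?oppr0 ?addr0 oner_eq0.
Qed.

(** [zdet] is a polynomial in z, so once it is known z = 1 may be substituted and [h] applied to the
    coefficients. *)
Lemma zeta_rev_det G G' (R : comNzRingType) (h : {rmorphism A -> R}) (t u : bool -> R) :
  (forall b, h (zt f b) = t b) -> (forall b, h (zu f b) = u b) ->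
  simple_digraph G -> simple_digraph G' ->
  zeta G =1 zeta G' -> rev_det t u G = rev_det t u G'.
Proof.
move=> ht hu simple simple' /(zeta_zdet simple simple').
rewrite !zdet_rev_det => /(congr1 (horner_eval 1 \o map_poly h)).
rewrite !rmorph_rev_det /=.
set t' := (X in rev_det X _ G = _); set u' := (X in rev_det _ X G = _).
have tE : t' =1 t by move=> b; rewrite /t' map_polyC /horner_eval hornerC; apply: ht.
have uE : u' =1 u.
  move=> b; rewrite /u' rmorphM /= map_polyX map_polyC /horner_eval hornerM hornerX hornerC.
  by rewrite mul1r; apply: hu.
by rewrite !(eq_rev_det _ tE uE).
Qed.

End Zeta.

(** With t and u kept as variables, the identity serves as the injective [f] asked for by
    [zdet_zeta], and every choice of t and u in a commutative ring is a specialization. *)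
Definition zring : idomainType := {mpoly {mpoly int[2]}[2]}.

Lemma zring_char0 n : n.+1%:R != 0 :> zring.
Proof. exact: (mpoly_char0 2 (mpoly_char0 2 int_char0) n). Qed.

Definition zring_id : {rmorphism {mpoly {mpoly int[2]}[2]} -> zring} := idfun.

Lemma zeta_eta G G' : simple_digraph G -> simple_digraph G' -> #|vert G| = #|vert G'| ->
  zeta G =1 zeta G' -> eta G = eta G'.
Proof.
move=> simple simple' nE h; apply: rev_det_eta nE => R t u.
pose p1 : {rmorphism {mpoly int[2]} -> R} := mmap intr (fun i => t (i == v_up)).
pose p2 : {rmorphism {mpoly {mpoly int[2]}[2]} -> R} := mmap p1 (fun i => u (i == v_up)).
have p1E b : p1 'X_(if b then v_up else v_dn) = t b by rewrite /= mmapX mmap1U; case: b.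
apply: (@zeta_rev_det zring zring_id zring_char0 G G' R p2 t u) => // b.
  by rewrite -p1E /p2 /zt /= mmapC.
by rewrite /p2 /zu /= mmapX mmap1U; case: b.
Qed.

Lemma eta_zeta G G' : simple_digraph G -> simple_digraph G' ->
  eta G = eta G' -> zeta G =1 zeta G'.
Proof.
move=> simple simple' h.
by apply: (@zdet_zeta zring zring_id zring_char0) => //; apply: eta_zdet.
Qed.

Local Close Scope ring_scope.

Theorem theorem4 (G G' : digraph)
    (simpleG : simple_digraph G) (simpleG' : simple_digraph G')
    (cardGG' : #|vert G| = #|vert G'|) :
  [<-> zeta G =1 zeta G';
       eta G = eta G';
       forall S : invader, eta (invaded S G) = eta (invaded S G');
       forall S : invader, chi (invaded S G) = chi (invaded S G');
       forall S : invader, #|vert S| = 2 ->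
         (forall i j, (0 < adj_mx S i j)%R) ->
         chi (invaded S G) = chi (invaded S G')].
Proof.
tfae.
- exact: zeta_eta.
- by move=> e S; apply: eta_invaded.
- by move=> e S; apply: eta_eq_chi.
- by move=> e S _ _; apply: e.
- by move/eta_of_two_vertex; apply: eta_zeta.
Qed.
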